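(* Let $G$ be a strongly connected directed graph. Then for any $A\in\mathfrak{L}_G$, $$\mathscr{D}(A)^-\cap Z(\mathfrak{L}_G)\neq\emptyset,$$ where $\mathscr{D}(A)^-$ is the weak-operator closure of $\mathscr{D}(A)$ in $B(\mathcal{H}_G)$. In particular, $\mathscr{D}(A)\cap Z(\mathfrak{L}_G)\neq\emptyset$ if $G$ is an $n$-circle graph.
   Context: A directed graph $G=(\mathcal{V},\mathcal{E},s,r)$ has a vertex set $\mathcal{V}$ and an edge set $\mathcal{E}$ (each of arbitrary cardinality; loops and multiple edges allowed) and source and range maps $s,r\colon\mathcal{E}\to\mathcal{V}$; an edge $e$ is an arrow from $s(e)$ to $r(e)$. $\mathbb{F}_G^+$ is the set of all directed paths of finite length: vertices $v$ are paths of length $0$ with $r(v)=s(v)=v$, and a path of length $n\geq1$ is $p=e_1e_2\cdots e_n$ with $s(e_j)=r(e_{j+1})$, $r(p)=r(e_1)$, $s(p)=s(e_n)$; if $s(p_1)=r(p_2)$, the product $p_1p_2$ is the concatenation. Let $\mathcal{H}_G=\ell^2(\mathbb{F}_G^+)$ with orthonormal basis $\{\xi_w\}$. For $e\in\mathcal{E}$, $L_e\xi_w=\xi_{ew}$ if $r(w)=s(e)$ and $0$ otherwise; for $x\in\mathcal{V}$, $L_x\xi_w=\xi_w$ if $r(w)=x$ and $0$ otherwise. $\mathfrak{L}_G$ is the weak-operator closed algebra generated by $\{L_e,L_x\colon e\in\mathcal{E},x\in\mathcal{V}\}$ in $B(\mathcal{H}_G)$, and $Z(\mathfrak{L}_G)$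 is its center. $G$ is strongly connected if for any vertices $x,y$ there is a directed path from $x$ to $y$ (a single vertex with no edge is strongly connected). An $n$-circle graph ($n\geq1$) has distinct vertices $v_1,\dots,v_n$ and edges $e_1,\dots,e_n$ with $r(e_j)=v_j$, $s(e_j)=v_{j+1\,(\mathrm{mod}\,n)}$. $\mathscr{D}$ is the set of all maps $\alpha\colon B(\mathcal{H}_G)\to B(\mathcal{H}_G)$ of the form $\alpha(A)=\frac1n\sum_{j=1}^nU_j^*AU_j$, where $n\geq1$ and every $U_j$ is an isometry belonging to $\mathfrak{L}_G$. For $A\in\mathfrak{L}_G$, $\mathscr{D}(A)=\{\alpha(A)\colon\alpha\in\mathscr{D}\}$. *)

(* Defs.v *)
From HB Require Import structures.
From mathcomp Require Import all_boot all_order all_algebra.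
From mathcomp Require Import finmap complex ring lra.
From mathcomp Require Import all_classical all_reals.
From mathcomp Require Import ereal topology normedtype numfun esum.
Import Order.TTheory GRing.Theory Num.Theory.
Import numFieldNormedType.Exports.
Local Open Scope classical_set_scope.
Local Open Scope ring_scope.

Set Implicit Arguments.
Unset Strict Implicit.
Unset Printing Implicit Defensive.
Import ComplexField.Normc.

Section rsum.
Variables (X : choiceType) (R : realType).
Implicit Types (h a b : X -> R).

(* Unordered sum of a family indexed by an arbitrary set. It is meaningful for
   absolutely summable families; every family it is applied to below is one. *)
Definition rsum h : R :=
  fine (\esum_(x in setT) (h^\+ x)%:E) - fine (\esum_(x in setT) (h^\- x)%:E).

Definition rsummable h := (\esum_(x in setT) `|h x|%:E < +oo)%E.

Lemma le_rsummable h a : (forall x, `|h x| <= a x) ->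
  (\esum_(x in setT) (a x)%:E < +oo)%E -> rsummable h.
Proof.
by move=> ha; apply: le_lt_trans; apply: le_esum => x _; rewrite lee_fin.
Qed.

Lemma esum_EFin_fin a : (forall x, 0 <= a x) ->
  (\esum_(x in setT) (a x)%:E < +oo)%E ->
  \esum_(x in setT) (a x)%:E = (fine (\esum_(x in setT) (a x)%:E))%:E.
Proof.
by move=> a0 aoo; rewrite fineK// ge0_fin_numE// esum_ge0// => x _; rewrite lee_fin.
Qed.

Lemma esum_posneg_lty h : rsummable h ->
  (\esum_(x in setT) (h^\+ x)%:E < +oo)%E /\
  (\esum_(x in setT) (h^\- x)%:E < +oo)%E.
Proof.
move=> hs; split; apply: le_lt_trans hs; apply: le_esum => x _; rewrite lee_fin.
  by rewrite /funrpos ge_max normr_ge0 ler_norm.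
by rewrite /funrneg ge_max normr_ge0 -normrN ler_norm.
Qed.

Lemma rsum_diff h a b :
  (forall x, 0 <= a x) -> (forall x, 0 <= b x) -> h =1 a \- b ->
  (\esum_(x in setT) (a x)%:E < +oo)%E ->
  (\esum_(x in setT) (b x)%:E < +oo)%E ->
  rsum h = fine (\esum_(x in setT) (a x)%:E) - fine (\esum_(x in setT) (b x)%:E).
Proof.
move=> a0 b0 hab aoo boo.
have hs : rsummable h.
  apply: (@le_rsummable _ (a \+ b)).
    by move=> x; rewrite hab /= (le_trans (ler_normB _ _))// !ger0_norm.
  have -> : \esum_(x in setT) ((a \+ b) x)%:E =
            (\esum_(x in setT) (a x)%:E + \esum_(x in setT) (b x)%:E)%E.
    by rewrite -esumD// => x _; rewrite lee_fin.
  exact: lte_add_pinfty.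
have [poo noo] := esum_posneg_lty hs.
have p0 x : 0 <= h^\+ x by exact: funrpos_ge0.
have n0 x : 0 <= h^\- x by exact: funrneg_ge0.
suff E : fine (\esum_(x in setT) (h^\+ x)%:E) + fine (\esum_(x in setT) (b x)%:E)
    = fine (\esum_(x in setT) (a x)%:E) + fine (\esum_(x in setT) (h^\- x)%:E).
  rewrite /rsum; apply/eqP; rewrite subr_eq addrAC eq_sym subr_eq eq_sym; exact/eqP.
apply: EFin_inj; rewrite !EFinD -!esum_EFin_fin//.
rewrite -!esumD; do ?by move=> x _; rewrite lee_fin.
apply: eq_esum => x _; rewrite -!EFinD; congr EFin.
have : h^\+ x - h^\- x = a x - b x.
  by rewrite -[RHS]hab -[in RHS](funrposBneg h).
by move=> /eqP; rewrite subr_eq addrAC eq_sym subr_eq => /eqP.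
Qed.

Lemma rsum_ge0E h : (forall x, 0 <= h x) -> rsummable h ->
  rsum h = fine (\esum_(x in setT) (h x)%:E).
Proof.
move=> h0 hs.
have hoo : (\esum_(x in setT) (h x)%:E < +oo)%E.
  by apply: le_lt_trans hs; apply: le_esum => x _; rewrite lee_fin ler_norm.
rewrite (@rsum_diff h h (fun=> 0))//.
- by rewrite [X in _ - fine X]esum1 ?subr0.
- by move=> x /=; rewrite subr0.
- by rewrite esum1 ?ltry.
Qed.

Lemma rsummableD h1 h2 : rsummable h1 -> rsummable h2 -> rsummable (h1 \+ h2).
Proof.
move=> s1 s2.
apply: (@le_rsummable _ (fun x => `|h1 x| + `|h2 x|)).
  by move=> x /=; exact: ler_normD.
have -> : \esum_(x in setT) (`|h1 x| + `|h2 x|)%:E =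
  (\esum_(x in setT) `|h1 x|%:E + \esum_(x in setT) `|h2 x|%:E)%E.
  by rewrite -esumD// => x _; rewrite lee_fin.
exact: lte_add_pinfty.
Qed.

Lemma rsumD h1 h2 : rsummable h1 -> rsummable h2 ->
  rsum (h1 \+ h2) = rsum h1 + rsum h2.
Proof.
move=> s1 s2.
have [p1 n1] := esum_posneg_lty s1.
have [p2 n2] := esum_posneg_lty s2.
have E (a b : X -> R) : (forall x, 0 <= a x) -> (forall x, 0 <= b x) ->
   \esum_(x in setT) ((a \+ b) x)%:E =
   (\esum_(x in setT) (a x)%:E + \esum_(x in setT) (b x)%:E)%E.
  by move=> a0 b0; rewrite -esumD// => x _; rewrite lee_fin.
rewrite (@rsum_diff _ (h1^\+ \+ h2^\+) (h1^\- \+ h2^\-)).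
- rewrite !E; do ?[by exact: funrpos_ge0|by exact: funrneg_ge0].
  rewrite !fineD ?ge0_fin_numE ?esum_ge0//; last first.
  all: try by move=> x _; rewrite lee_fin ?funrpos_ge0 ?funrneg_ge0.
  by rewrite /rsum opprD addrACA.
- by move=> x /=; rewrite addr_ge0 ?funrpos_ge0.
- by move=> x /=; rewrite addr_ge0 ?funrneg_ge0.
- move=> x /=; rewrite opprD addrACA.
  by rewrite -[in LHS](funrposBneg h1) -[in LHS](funrposBneg h2).
- rewrite E; do ?[by exact: funrpos_ge0|by exact: funrneg_ge0].
  exact: lte_add_pinfty.
- rewrite E; do ?[by exact: funrpos_ge0|by exact: funrneg_ge0].
  exact: lte_add_pinfty.
Qed.

Lemma le_esumZ (c : R) a : 0 <= c -> (forall x, 0 <= a x) ->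
  (\esum_(x in setT) (c * a x)%:E <= c%:E * \esum_(x in setT) (a x)%:E)%E.
Proof.
move=> c0 a0; apply: ge_ereal_sup => _ [F [finF FT] <-].
under eq_fsbigr do rewrite EFinM.
rewrite -ge0_mule_fsumr; last by move=> x; rewrite lee_fin.
apply: lee_wpmul2l; first by rewrite lee_fin.
by apply: esum_ge; exists F.
Qed.

Lemma esumZ (c : R) a : 0 <= c -> (forall x, 0 <= a x) ->
  \esum_(x in setT) (c * a x)%:E = (c%:E * \esum_(x in setT) (a x)%:E)%E.
Proof.
move=> c0 a0; apply/eqP; rewrite eq_le le_esumZ//=.
have [->|cn0] := eqVneq c 0.
  by rewrite mul0e esum_ge0// => x _; rewrite lee_fin mul0r.
have {cn0 c0} c0 : 0 < c by rewrite lt_def cn0.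
have ci0 : 0 <= c^-1 by rewrite invr_ge0 ltW.
have ca0 x : 0 <= c * a x by rewrite mulr_ge0// ltW.
have := le_esumZ ci0 ca0.
have -> : \esum_(x in setT) (c^-1 * (c * a x))%:E = \esum_(x in setT) (a x)%:E.
  by apply: eq_esum => x _; rewrite mulKf// gt_eqF.
move=> /(lee_wpmul2l (_ : (0 <= c%:E)%E)) => /(_ (ltW c0)).
by rewrite muleA -EFinM mulfV ?gt_eqF// mul1e.
Qed.

Lemma rsummableZ c h : rsummable h -> rsummable (fun x => c * h x).
Proof.
move=> s; rewrite /rsummable.
under eq_esum do rewrite normrM.
rewrite esumZ//; apply: lte_mul_pinfty => //.
Qed.

Lemma rsumZ c h : rsummable h -> rsum (fun x => c * h x) = c * rsum h.
Proof.
move=> s; have [p n] := esum_posneg_lty s.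
have Ep (d : R) : 0 <= d -> \esum_(x in setT) (d * h^\+ x)%:E =
    (d%:E * \esum_(x in setT) (h^\+ x)%:E)%E.
  by move=> d0; rewrite esumZ// => x; rewrite funrpos_ge0.
have En (d : R) : 0 <= d -> \esum_(x in setT) (d * h^\- x)%:E =
    (d%:E * \esum_(x in setT) (h^\- x)%:E)%E.
  by move=> d0; rewrite esumZ// => x; rewrite funrneg_ge0.
have hp : \esum_(x in setT) (h^\+ x)%:E \is a fin_num.
  by rewrite ge0_fin_numE// esum_ge0// => x _; rewrite lee_fin funrpos_ge0.
have hn : \esum_(x in setT) (h^\- x)%:E \is a fin_num.
  by rewrite ge0_fin_numE// esum_ge0// => x _; rewrite lee_fin funrneg_ge0.
have [c0|c0] := leP 0 c.
  rewrite (@rsum_diff _ (fun x => c * h^\+ x) (fun x => c * h^\- x)).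
  - by rewrite Ep// En// !fineM// /rsum mulrBr.
  - by move=> x; rewrite mulr_ge0// funrpos_ge0.
  - by move=> x; rewrite mulr_ge0// funrneg_ge0.
  - by move=> x /=; rewrite -mulrBr -[in LHS](funrposBneg h).
  - by rewrite Ep//; apply: lte_mul_pinfty.
  - by rewrite En//; apply: lte_mul_pinfty.
have d0 : 0 <= - c by rewrite oppr_ge0 ltW.
rewrite (@rsum_diff _ (fun x => - c * h^\- x) (fun x => - c * h^\+ x)).
- by rewrite Ep// En// !fineM//= /rsum -mulrBr mulNr -mulrN opprB.
- by move=> x; rewrite mulr_ge0// funrneg_ge0.
- by move=> x; rewrite mulr_ge0// funrpos_ge0.
- by move=> x /=; rewrite -mulrBr mulNr -mulrN opprB -[in LHS](funrposBneg h).
- by rewrite En//; apply: lte_mul_pinfty.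
- by rewrite Ep//; apply: lte_mul_pinfty.
Qed.

End rsum.

Section csum.
Variables (X : choiceType) (R : realType).
Implicit Types h : X -> R[i].

Definition csum h : R[i] :=
  Complex (rsum (fun x => complex.Re (h x))) (rsum (fun x => complex.Im (h x))).

Definition csummable h := rsummable (fun x => normc (h x)).

Lemma normc_ge0 (z : R[i]) : 0 <= normc z.
Proof. by case: z => a b; exact: sqrtr_ge0. Qed.

Lemma sqr_normcE (z : R[i]) : normc z ^+ 2 = complex.Re z ^+ 2 + complex.Im z ^+ 2.
Proof. by case: z => a b; rewrite sqr_sqrtr// addr_ge0// sqr_ge0. Qed.

Lemma Re_le_normc (z : R[i]) : `|complex.Re z| <= normc z.
Proof.
rewrite -(@ler_pXn2r _ 2)// ?nnegrE ?normc_ge0// sqr_normcE real_normK ?num_real//.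
by rewrite lerDl sqr_ge0.
Qed.

Lemma Im_le_normc (z : R[i]) : `|complex.Im z| <= normc z.
Proof.
rewrite -(@ler_pXn2r _ 2)// ?nnegrE ?normc_ge0// sqr_normcE real_normK ?num_real//.
by rewrite lerDr sqr_ge0.
Qed.

Lemma normc_real (r : R) : normc (Complex r 0) = `|r|.
Proof. by rewrite /normc expr0n addr0 sqrtr_sqr. Qed.

Lemma normcJ (z : R[i]) : normc (conjc z) = normc z.
Proof. by case: z => a b; rewrite /normc/= sqrrN. Qed.

Lemma csummable_Re h : csummable h -> rsummable (fun x => complex.Re (h x)).
Proof.
move=> hs; apply: (@le_rsummable _ _ _ (fun x => normc (h x))).
  by move=> x; exact: Re_le_normc.
by move: hs; rewrite /csummable/rsummable; under eq_esum do rewrite ger0_norm ?normc_ge0//.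
Qed.

Lemma csummable_Im h : csummable h -> rsummable (fun x => complex.Im (h x)).
Proof.
move=> hs; apply: (@le_rsummable _ _ _ (fun x => normc (h x))).
  by move=> x; exact: Im_le_normc.
by move: hs; rewrite /csummable/rsummable; under eq_esum do rewrite ger0_norm ?normc_ge0//.
Qed.

Lemma csumD h1 h2 : csummable h1 -> csummable h2 ->
  csum (fun x => h1 x + h2 x) = csum h1 + csum h2.
Proof.
move=> s1 s2; rewrite /csum.
have -> : (fun x => complex.Re (h1 x + h2 x)) =
    (fun x => complex.Re (h1 x)) \+ (fun x => complex.Re (h2 x)).
  by apply/funext => x; rewrite /=; case: (h1 x) (h2 x) => ? ? [].
have -> : (fun x => complex.Im (h1 x + h2 x)) =
    (fun x => complex.Im (h1 x)) \+ (fun x => complex.Im (h2 x)).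
  by apply/funext => x; rewrite /=; case: (h1 x) (h2 x) => ? ? [].
by rewrite (rsumD (csummable_Re s1) (csummable_Re s2))
  (rsumD (csummable_Im s1) (csummable_Im s2)).
Qed.

Lemma csumZ (c : R[i]) h : csummable h -> csum (fun x => c * h x) = c * csum h.
Proof.
move=> hs; have sR := csummable_Re hs; have sI := csummable_Im hs.
case: c => a b; rewrite /csum.
have -> : (fun x => complex.Re (Complex a b * h x)) =
    (fun x => a * complex.Re (h x)) \+ (fun x => (- b) * complex.Im (h x)).
  by apply/funext => x; rewrite /=; case: (h x) => c d /=; rewrite mulNr.
have -> : (fun x => complex.Im (Complex a b * h x)) =
    (fun x => a * complex.Im (h x)) \+ (fun x => b * complex.Re (h x)).
  by apply/funext => x; rewrite /=; case: (h x) => c d.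
rewrite (rsumD (rsummableZ a sR) (rsummableZ (- b) sI)).
rewrite (rsumD (rsummableZ a sI) (rsummableZ b sR)).
by rewrite !(rsumZ _ sR, rsumZ _ sI) mulNr.
Qed.

Lemma csum_conj h : csummable h -> csum (fun x => conjc (h x)) = conjc (csum h).
Proof.
move=> hs; rewrite /csum /=; congr Complex.
  by congr rsum; apply/funext => x; case: (h x).
rewrite -mulN1r -rsumZ; last exact: csummable_Im.
by congr rsum; apply/funext => x; case: (h x) => a b; rewrite mulN1r.
Qed.

End csum.

Section ell2.
Variables (X : choiceType) (R : realType).
Local Notation C := R[i].

Definition sqsum (f : X -> C) : \bar R :=
  \esum_(x in setT) ((normc (f x)) ^+ 2)%:E.

Definition ell2_pred : {pred X -> C} := fun f => (sqsum f < +oo)%E.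

Lemma sqsum_ge0 f : (0 <= sqsum f)%E.
Proof. by apply: esum_ge0 => x _; rewrite lee_fin sqr_ge0. Qed.

Lemma ell2_submod_closed : submod_closed ell2_pred.
Proof.
split.
  rewrite unfold_in /sqsum esum1 ?ltry// => x _.
  by rewrite (_ : normc _ = 0) ?expr0n//; exact: normc0.
move=> a f g; rewrite !unfold_in => fs gs.
pose A := 2 * normc a ^+ 2.
have A0 : 0 <= A by rewrite mulr_ge0// sqr_ge0.
apply: (@le_lt_trans _ _
    (\esum_(x in setT) (A * normc (f x) ^+ 2)%:E +
     \esum_(x in setT) (2 * normc (g x) ^+ 2)%:E)%E).
  rewrite -esumD; first last.
  - by move=> x _; rewrite lee_fin mulr_ge0// sqr_ge0.
  - by move=> x _; rewrite lee_fin mulr_ge0// sqr_ge0.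
  apply: le_esum => x _; rewrite -EFinD lee_fin.
  have h : normc (a * f x + g x) <= normc a * normc (f x) + normc (g x).
    by rewrite -normcM le_normcD.
  rewrite (@le_trans _ _ ((normc a * normc (f x) + normc (g x)) ^+ 2))//.
    by rewrite ler_pXn2r ?nnegrE ?normc_ge0// addr_ge0 ?mulr_ge0 ?normc_ge0.
  rewrite /A -mulrA -exprMn -mulrDr; set u := normc a * _; set v := normc _.
  rewrite -subr_ge0 [leRHS](_ : _ = (u - v) ^+ 2) ?sqr_ge0//.
  by rewrite sqrrD sqrrB mulr_natl mulr2n; ring.
rewrite !esumZ//; do ?by move=> x; rewrite sqr_ge0.
by apply: lte_add_pinfty; apply: lte_mul_pinfty.
Qed.

HB.instance Definition _ := GRing.isSubmodClosed.Build _ _ ell2_pred ell2_submod_closed.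

Record ell2 : Type := Ell2 {ell2_val :> X -> C; _ : ell2_val \in ell2_pred}.
HB.instance Definition _ := [isSub for ell2_val].
HB.instance Definition _ := [Choice of ell2 by <:].
HB.instance Definition _ := [SubChoice_isSubLmodule of ell2 by <:].

Definition l2norm (f : ell2) : R := Num.sqrt (fine (sqsum f)).

(* linear in the first argument, conjugate-linear in the second *)
Definition l2dot (f g : ell2) : C := csum (fun x => f x * (g x)^*).

Lemma ell2P (f g : ell2) : (forall x, f x = g x) -> f = g.
Proof. by move=> fg; apply/val_inj/funext. Qed.

Lemma ell2D (f g : ell2) x : (f + g) x = f x + g x. Proof. by []. Qed.
Lemma ell2Z a (f : ell2) x : (a *: f) x = a * f x. Proof. by []. Qed.
Lemma ell20 x : (0 : ell2) x = 0. Proof. by []. Qed.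

End ell2.

Section ell2_theory.
Variables (X : choiceType) (R : realType).
Local Notation C := R[i].
Local Notation H := (ell2 X R).
Implicit Types f g : H.

Lemma sqsum_fin f : sqsum f \is a fin_num.
Proof. by rewrite ge0_fin_numE ?sqsum_ge0//; case: f. Qed.

Lemma sqr_l2norm f : (l2norm f ^+ 2)%:E = sqsum f.
Proof. by rewrite sqr_sqrtr ?fineK ?sqsum_fin// fine_ge0// sqsum_ge0. Qed.

Lemma l2norm_ge0 f : 0 <= l2norm f. Proof. exact: sqrtr_ge0. Qed.

Lemma l2dot_csummable f g : csummable (fun x => f x * (g x)^*).
Proof.
have hf : (sqsum f < +oo)%E by case: (f).
have hg : (sqsum g < +oo)%E by case: (g).
apply: (@le_rsummable _ _ _ (fun x => normc (f x) ^+ 2 + normc (g x) ^+ 2)).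
  move=> x; rewrite ger0_norm ?normc_ge0// normcM [normc (_ ^*)]normcJ.
  set u := normc _; set v := normc _.
  have u0 : 0 <= u by exact: normc_ge0.
  have v0 : 0 <= v by exact: normc_ge0.
  nra.
under eq_esum do rewrite EFinD.
rewrite esumD; do ?by move=> x _; rewrite lee_fin sqr_ge0.
exact: lte_add_pinfty.
Qed.

Lemma l2dot_linear g : linear_for *%R (fun f => l2dot f g).
Proof.
move=> a f1 f2 /=; rewrite /l2dot -(csumZ _ (l2dot_csummable f1 g)).
rewrite -csumD; last exact: l2dot_csummable.
  congr csum; apply/funext => x; rewrite ell2D ell2Z mulrDl mulrA//.
have := l2dot_csummable (a *: f1) g.
by congr csummable; apply/funext => x; rewrite ell2Z mulrA.
Qed.

Lemma l2dotC f g : l2dot f g = (l2dot g f)^*.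
Proof.
rewrite /l2dot -[RHS]csum_conj; last exact: l2dot_csummable.
congr csum; apply/funext => x.
have E (z : C) : conjc z = z^* by [].
by rewrite E rmorphM /= conjCK mulrC.
Qed.

Lemma l2dot_linearr f : linear_for (@Num.conj C \; *%R) (l2dot f).
Proof.
move=> a g1 g2 /=; rewrite l2dotC [LHS](congr1 _ (l2dot_linear f a g1 g2)).
rewrite rmorphD rmorphM [l2dot f g1]l2dotC [l2dot f g2]l2dotC. by [].
Qed.

Lemma l2dotff f : l2dot f f = (l2norm f ^+ 2)%:C%C.
Proof.
have E x : f x * (f x)^* = Complex (normc (f x) ^+ 2) 0.
  rewrite sqr_normcE; case: (f x) => a b.
  rewrite -[LHS]/(Complex (a * a - b * (- b)) (a * (- b) + b * a)).
  by congr Complex => /=; ring.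
have hf : (sqsum f < +oo)%E by case: (f).
rewrite /l2dot; under eq_fun do rewrite E.
rewrite /csum /=; congr Complex.
  rewrite rsum_ge0E; first by apply: EFin_inj; rewrite sqr_l2norm fineK ?sqsum_fin.
    by move=> x; exact: sqr_ge0.
  by rewrite /rsummable; under eq_esum do rewrite ger0_norm ?sqr_ge0//.
rewrite rsum_ge0E//; first by rewrite esum1.
by rewrite /rsummable esum1 ?ltry// => x _; rewrite normr0.
Qed.

Lemma l2norm_eq0 f : l2norm f = 0 -> f = 0.
Proof.
move=> f0; apply: ell2P => x; rewrite ell20; apply: eq0_normc.
have : ((normc (f x) ^+ 2)%:E <= 0)%E.
  have <- : sqsum f = 0 by rewrite -sqr_l2norm f0 expr0n.
  apply: esum_ge; exists [set x]; last by rewrite fsbig_set1.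
  by split => //; exact: finite_set1.
by rewrite lee_fin => h; apply/eqP; rewrite -sqrf_eq0 eq_le h sqr_ge0.
Qed.

Lemma l2dot_gt0 f : f != 0 -> 0 < l2dot f f.
Proof.
move=> f0; rewrite l2dotff ltcR lt_def sqr_ge0 andbT sqrf_eq0.
by apply: contra f0 => /eqP/l2norm_eq0 ->.
Qed.

HB.instance Definition _ := @bilinear_isBilinear.Build C H H C *%R (Num.conj \; *%R)
  (@l2dot X R) (l2dot_linear, l2dot_linearr).
Fact l2dot_herm f g : l2dot f g = (-1) ^+ false * (l2dot g f)^*.
Proof. by rewrite expr0 mul1r; exact: l2dotC. Qed.
HB.instance Definition _ := @isHermitianSesquilinear.Build C H false Num.conj
  (@l2dot X R) l2dot_herm.
HB.instance Definition _ := @isDotProduct.Build C H (@l2dot X R) l2dot_gt0.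

End ell2_theory.

Section ell2_basis.
Variables (X : choiceType) (R : realType).
Local Notation C := R[i].
Local Notation H := (ell2 X R).
Implicit Types f g : H.

Lemma l2norm0 : l2norm (0 : H) = 0.
Proof.
rewrite /l2norm (_ : sqsum _ = 0) ?sqrtr0// /sqsum esum1// => x _.
by rewrite (_ : normc _ = 0) ?expr0n//; exact: normc0.
Qed.

Lemma normc_sqrC (z : C) : `|z| ^+ 2 = (normc z ^+ 2)%:C%C.
Proof. by rewrite -[ `|z| ]/((normc z)%:C%C) rmorphXn. Qed.

Lemma l2dotZZ a f : l2dot (a *: f) (a *: f) = `|a| ^+ 2 * l2dot f f.
Proof. by rewrite linearZl_LR linearZr_LR/= mulrA normCK. Qed.

Lemma l2dot_le f g : normc (l2dot f g) <= l2norm f * l2norm g.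
Proof.
have [->|g0] := eqVneq g 0.
  by rewrite linear0r l2norm0 mulr0 (_ : normc _ = 0)//; exact: normc0.
have d0 : l2dot g g != 0 by rewrite gt_eqF// l2dot_gt0.
rewrite -(@ler_pXn2r _ 2)// ?nnegrE ?normc_ge0 ?mulr_ge0 ?l2norm_ge0//.
pose a := l2dot f g / l2dot g g; pose u := f - a *: g.
have ug : l2dot u g = 0.
  by rewrite /u linearBl/= linearZl_LR/= divfK// subrr.
have fE : f = u + a *: g by rewrite subrK.
have : l2dot f f = l2dot u u + `|a| ^+ 2 * l2dot g g.
  have o : l2dot u (a *: g) = 0 by rewrite linearZr_LR/= ug mulr0.
  by rewrite {1 2}fE (hnormDd o) /= l2dotZZ.
rewrite !l2dotff normc_sqrC -rmorphM -rmorphD => /complexI E.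
have : normc (l2dot f g) = normc a * l2norm g ^+ 2.
  rewrite -(ger0_norm (sqr_ge0 (l2norm g))) -normc_real -normcM.
  by rewrite -[Complex _ 0]/((l2norm g ^+ 2)%:C%C) -l2dotff divfK.
move=> ->; rewrite !exprMn E.
have := sqr_ge0 (l2norm u); have := sqr_ge0 (l2norm g); nra.
Qed.

Lemma l2normZ a f : l2norm (a *: f) = normc a * l2norm f.
Proof.
apply: (@pexpIrn _ 2) => //; rewrite ?nnegrE ?l2norm_ge0 ?mulr_ge0 ?l2norm_ge0 ?normc_ge0//.
apply: complexI; rewrite -l2dotff l2dotZZ l2dotff normc_sqrC -rmorphM exprMn//.
Qed.

Lemma l2normD f g : l2norm (f + g) <= l2norm f + l2norm g.
Proof.
rewrite -(@ler_pXn2r _ 2)// ?nnegrE ?addr_ge0 ?l2norm_ge0//.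
have := l2dotff (f + g); rewrite (dnormD (@l2dot X R)) /= !l2dotff => E.
have {E} E : l2norm (f + g) ^+ 2 =
    l2norm f ^+ 2 + l2norm g ^+ 2 + 2 * complex.Re (l2dot f g).
  move: E => /(congr1 (@complex.Re R)) /= <-.
  by case: (l2dot f g) => a b /=; ring.
have := le_trans (ler_norm _) (le_trans (Re_le_normc _) (l2dot_le f g)).
rewrite E; nra.
Qed.

Lemma l2normN f : l2norm (- f) = l2norm f.
Proof.
by apply: (@pexpIrn _ 2) => //; rewrite ?nnegrE ?l2norm_ge0//;
  apply: complexI; rewrite -!l2dotff (hnormN (@l2dot X R) f).
Qed.

(* [xi x] is the orthonormal basis vector at [x] *)
Definition delta_fun (x y : X) : C := (y == x)%:R.

Fact delta_in x : delta_fun x \in @ell2_pred X R.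
Proof.
rewrite unfold_in /sqsum (esumID [set x]); last first.
  by move=> y _; rewrite lee_fin sqr_ge0.
rewrite setTI esum_set1 ?lee_fin ?sqr_ge0// esum1 ?adde0 ?ltry// => y [_ /= /eqP yx].
rewrite /delta_fun (negPf yx) (_ : normc _ = 0) ?expr0n//; exact: normc0.
Qed.

Definition xi x : H := Ell2 (delta_in x).

Lemma xiE x y : xi x y = (y == x)%:R. Proof. by []. Qed.

Lemma rsum_single (h : X -> R) x : (forall y, y != x -> h y = 0) -> rsum h = h x.
Proof.
move=> h0.
have E (a : X -> R) : (forall y, 0 <= a y) -> (forall y, y != x -> a y = 0) ->
   \esum_(y in setT) (a y)%:E = (a x)%:E.
  move=> a0 ax; rewrite (esumID [set x]); last by move=> y _; rewrite lee_fin.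
  by rewrite setTI esum_set1 ?lee_fin// esum1 ?adde0// => y [_ /= /eqP yx]; rewrite ax.
rewrite /rsum !E.
- by rewrite /= -[in RHS](funrposBneg h).
- exact: funrneg_ge0.
- by move=> y /h0 hy; rewrite /funrneg hy oppr0 maxxx.
- exact: funrpos_ge0.
- by move=> y /h0 hy; rewrite /funrpos hy maxxx.
Qed.

Lemma l2dot_xi f x : l2dot f (xi x) = f x.
Proof.
have E y : f y * (xi x y)^* = if y == x then f x else 0.
  rewrite xiE; case: eqVneq => [->|_] /=; first by rewrite conjC1 mulr1.
  by rewrite conjC0 mulr0.
rewrite /l2dot; under eq_fun do rewrite E.
rewrite /csum !(@rsum_single _ x) ?eqxx; first by case: (f x).
  by move=> y /negPf ->.
by move=> y /negPf ->.
Qed.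

Lemma l2dot_xil f x : l2dot (xi x) f = (f x)^*.
Proof. by rewrite l2dotC l2dot_xi. Qed.

Lemma l2norm_xi x : l2norm (xi x) = 1.
Proof.
apply: (@pexpIrn _ 2) => //; rewrite ?nnegrE ?l2norm_ge0 ?ler01//.
by apply: complexI; rewrite -l2dotff l2dot_xi xiE eqxx expr1n.
Qed.

Lemma trunc_val (c : X -> C) (F : {fset X}) y :
  (\sum_(x <- F) c x *: xi x) y = if y \in F then c y else 0.
Proof.
rewrite -[LHS]l2dot_xi linear_sumlz.
under eq_bigr do rewrite linearZl_LR /= l2dot_xi xiE.
have [yF|yF] := boolP (y \in F).
  rewrite (big_fsetD1 y)//= eqxx mulr1 big_seq big1 ?addr0// => x.
  by rewrite in_fsetD1 eq_sym => /andP[/negPf -> _]; rewrite mulr0.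
rewrite big_seq big1// => x xF; rewrite (_ : (y == x) = false) ?mulr0//.
by apply: contraNF yF => /eqP ->.
Qed.

Lemma ell2_approx f (e : R) : 0 < e ->
  exists F : {fset X}, l2norm (f - \sum_(x <- F) f x *: xi x) <= e.
Proof.
move=> e0.
have : (sqsum f - (e ^+ 2)%:E < sqsum f)%E.
  have := sqsum_fin f; case: (sqsum f) => [r||]// _.
  by rewrite -EFinB lte_fin ltrBlDr ltrDl exprn_gt0.
rewrite {2}/sqsum => /ereal_sup_gt[_ [A [finA _] <-]] hA.
exists (fset_set A); set g := f - _.
have gE y : g y = if y \in A then 0 else f y.
  rewrite /g ell2D -[(- _ : H) y]/(- ((\sum_(x <- fset_set A) f x *: xi x) y)).
  rewrite trunc_val in_fset_set//; case: ifP; by rewrite ?subrr ?subr0.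
have sf : sqsum f = (\sum_(x \in A) (normc (f x) ^+ 2)%:E + sqsum g)%E.
  rewrite {1}/sqsum (esumID A) ?setTI; last by move=> y _; rewrite lee_fin sqr_ge0.
  rewrite esum_fset//; last by move=> y _; rewrite lee_fin sqr_ge0.
  congr (_ + _)%E; rewrite esum_mkcond; apply: eq_esum => y _.
  rewrite gE in_setC; case: (y \in A); last by [].
  have nz : normc (0 : C) = 0 by exact: normc0.
  by rewrite nz expr0n.
rewrite -(@ler_pXn2r _ 2)// ?nnegrE ?l2norm_ge0 ?(ltW e0)//.
rewrite -lee_fin sqr_l2norm ltW//.
move: hA; rewrite sf.
have : sqsum g \is a fin_num by exact: sqsum_fin.
have : sqsum f \is a fin_num by exact: sqsum_fin.
rewrite sf fin_numD => /andP[].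
set a := (\sum_(_ \in _) _)%E; move: a (sqsum g) => [a||] [b||]//= _ _ _.
by rewrite !lte_fin => h; lra.
Qed.

Lemma functional_eq0 (phi : H -> C) (M : R) :
  (forall a f g, phi (a *: f + g) = a * phi f + phi g) ->
  (forall f, normc (phi f) <= M * l2norm f) ->
  (forall x, phi (xi x) = 0) -> forall f, phi f = 0.
Proof.
move=> lphi bphi phi0 f.
have phi00 : phi 0 = 0.
  have /eqP := lphi 1 0 0; rewrite scale1r mul1r addr0 -subr_eq subrr => /eqP h.
  by rewrite -h.
have phiS (F : {fset X}) : phi (\sum_(x <- F) f x *: xi x) = 0.
  elim/big_ind: _ => //.
    by move=> u v u0 v0; rewrite -[u]scale1r lphi u0 v0 mulr0 addr0.
  by move=> x _; rewrite -[_ *: _]addr0 lphi phi0 mulr0 phi00 addr0.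
apply: eq0_normc; apply/eqP; rewrite eq_le normc_ge0 andbT.
apply/ler_addgt0Pr => e e0; rewrite add0r.
have M1 : 0 < `|M| + 1 by rewrite ltr_wpDl.
have [F hF] := ell2_approx f (divr_gt0 e0 M1).
have -> : phi f = phi (f - \sum_(x <- F) f x *: xi x).
  rewrite addrC -scaleN1r lphi phiS mulr0 add0r//.
apply: le_trans (bphi _) _.
apply: (@le_trans _ _ ((`|M| + 1) * (e / (`|M| + 1)))).
  apply: (@le_trans _ _ (`|M| * l2norm (f - \sum_(x <- F) f x *: xi x))).
    by apply: ler_wpM2r; [exact: l2norm_ge0|exact: ler_norm].
  by apply: ler_pM => //; [exact: l2norm_ge0|rewrite lerDl].
by rewrite mulrC divfK// gt_eqF.
Qed.

End ell2_basis.

Section bop.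
Variables (X : choiceType) (R : realType).
Local Notation C := R[i].
Local Notation H := (ell2 X R).

Definition bounded_operator (T : H -> H) :=
  linear T /\ exists M : R, forall f, l2norm (T f) <= M * l2norm f.

Definition bop_pred : {pred H -> H} := fun T => `[< bounded_operator T >].

Lemma bop_submod_closed : submod_closed bop_pred.
Proof.
split.
  apply/asboolP; split => [a f g|]; first by rewrite /= scaler0 addr0.
  by exists 0 => f; rewrite mul0r /= l2norm0.
move=> a S T /asboolP[lS [MS hS]] /asboolP[lT [MT hT]]; apply/asboolP; split.
  move=> b f g; rewrite /= -[(a *: S + T) _]/(a *: S _ + T _) lS lT.
  rewrite -[(a *: S + T) f]/(a *: S f + T f) -[(a *: S + T) g]/(a *: S g + T g).
  by rewrite !scalerDr !scalerA [a * b]mulrC addrACA.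
exists (normc a * MS + MT) => f; rewrite -[(a *: S + T) f]/(a *: S f + T f).
rewrite (le_trans (l2normD _ _))// l2normZ mulrDl lerD// -mulrA.
by rewrite ler_wpM2l// normc_ge0.
Qed.

HB.instance Definition _ :=
  GRing.isSubmodClosed.Build _ _ bop_pred bop_submod_closed.

Record bop : Type := Bop {bop_val :> H -> H; _ : bop_val \in bop_pred}.
HB.instance Definition _ := [isSub for bop_val].
HB.instance Definition _ := [Choice of bop by <:].
HB.instance Definition _ := [SubChoice_isSubLmodule of bop by <:].

Implicit Types S T : bop.

Lemma bopP S T : (forall f, S f = T f) -> S = T.
Proof. by move=> ST; apply/val_inj/funext. Qed.

Lemma bop_bounded_operator T : bounded_operator T.
Proof. by case: T => T /= /asboolP. Qed.

Lemma bop_linear T : linear T.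
Proof. by have [] := bop_bounded_operator T. Qed.

Lemma bop_bounded T : exists M : R, forall f, l2norm (T f) <= M * l2norm f.
Proof. by have [] := bop_bounded_operator T. Qed.

Lemma bopD S T f : (S + T) f = S f + T f. Proof. by []. Qed.
Lemma bopZ a T f : (a *: T) f = a *: T f. Proof. by []. Qed.

Lemma bop0 T : T 0 = 0.
Proof.
by rewrite -[0 in LHS](subrr (0 : H)) -scaleN1r addrC bop_linear scaleN1r addNr.
Qed.

Fact bcomp_in S T : S \o T \in bop_pred.
Proof.
apply/asboolP; split => [a f g|]; first by rewrite /= !bop_linear.
have [MS hS] := bop_bounded S; have [MT hT] := bop_bounded T.
exists (`|MS| * MT) => f /=; apply: le_trans (hS _) _.
apply: (@le_trans _ _ (`|MS| * l2norm (T f))).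
  by rewrite ler_wpM2r ?l2norm_ge0 ?ler_norm.
by rewrite -mulrA ler_wpM2l.
Qed.
Definition bcomp S T : bop := Bop (bcomp_in S T).

Lemma bop_eq_xi S T : (forall x, S (xi R x) = T (xi R x)) -> S = T.
Proof.
move=> ST; apply: bopP => f; apply: ell2P => y.
apply/eqP; rewrite -subr_eq0; apply/eqP.
pose phi g := l2dot (S g - T g) (xi R y).
have [MS hS] := bop_bounded S; have [MT hT] := bop_bounded T.
suff : phi f = 0 by rewrite /phi l2dot_xi.
apply: (@functional_eq0 _ _ phi (MS + MT)) => [a g h|g|x].
- rewrite /phi !bop_linear opprD addrACA -scalerBr.
  by rewrite linearDl/= linearZl_LR.
- apply: le_trans (l2dot_le _ _) _; rewrite l2norm_xi mulr1.
  by apply: le_trans (l2normD _ _) _; rewrite l2normN mulrDl lerD.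
- by rewrite /phi ST subrr linear0l.
Qed.

Lemma bop_sum T (I : eqType) (s : seq I) (c : I -> C) (v : I -> H) :
  T (\sum_(i <- s) c i *: v i) = \sum_(i <- s) c i *: T (v i).
Proof.
elim: s => [|i s IH]; first by rewrite !big_nil bop0.
by rewrite !big_cons bop_linear IH.
Qed.

Definition is_adjoint T S := forall f g, l2dot (T f) g = l2dot f (S g).

(* The adjoint exists ([adjointP]) and is unique ([is_adjoint_unique]), so the
   default value 0 of [xget] is never taken. *)
Definition adjoint T : bop := xget 0 [set S | is_adjoint T S].

Lemma adjointP T : is_adjoint T (adjoint T).
Proof.
suff [S hS] : exists S, is_adjoint T S.
  exact: (@xgetPex _ 0 [set S | is_adjoint T S] (ex_intro _ S hS)).
have [M0 hM0] := bop_bounded T.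
pose M := `|M0|; have Mge0 : 0 <= M by exact: normr_ge0.
have hM f : l2norm (T f) <= M * l2norm f.
  by apply: le_trans (hM0 f) _; rewrite ler_wpM2r ?l2norm_ge0 ?ler_norm.
pose Vf (g : H) x := l2dot g (T (xi R x)).
have bnd g : (sqsum (Vf g) <= (M ^+ 2 * l2norm g ^+ 2)%:E)%E.
  apply: ge_ereal_sup => _ [A [finA _] <-].
  pose h : H := \sum_(x <- fset_set A) Vf g x *: xi R x.
  have hE x : h x = if x \in fset_set A then Vf g x else 0.
    by rewrite /h trunc_val.
  have nz : normc (0 : C) = 0 by exact: normc0.
  have sh : (\sum_(x \in A) (normc (Vf g x) ^+ 2)%:E)%E = (l2norm h ^+ 2)%:E.
    rewrite sqr_l2norm /sqsum (esumID A) ?setTI; last first.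
      by move=> y _; rewrite lee_fin sqr_ge0.
    rewrite esum_fset//; last by move=> y _; rewrite lee_fin sqr_ge0.
    rewrite [X in (_ + X)%E]esum1 ?adde0; last first.
      move=> y /= nAy; rewrite hE in_fset_set//.
      by rewrite memNset// nz expr0n.
    by apply: eq_fsbigr => x xA; rewrite hE in_fset_set// xA.
  have d : l2dot g (T h) = (l2norm h ^+ 2)%:C%C.
    rewrite -l2dotff {1}/h bop_sum linear_sumr {1}/h linear_sumlz !big_seq.
    apply: eq_bigr => x xA.
    by rewrite linearZr_LR /= linearZl_LR /= l2dot_xil hE xA mulrC.
  have le1 : l2norm h ^+ 2 <= M * l2norm g * l2norm h.
    have := l2dot_le g (T h); rewrite d normc_real ger0_norm ?sqr_ge0// => le0.
    apply: le_trans le0 _; rewrite [M * _]mulrC -mulrA; apply: ler_wpM2l => //.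
    exact: l2norm_ge0.
  have le2 : l2norm h <= M * l2norm g.
    have [h0|h0] := eqVneq (l2norm h) 0.
      by rewrite h0 mulr_ge0 ?l2norm_ge0.
    rewrite -(@ler_pM2r _ (l2norm h)) -?expr2//.
    by rewrite lt_def h0 l2norm_ge0.
  rewrite sh lee_fin -exprMn ler_pXn2r// nnegrE ?mulr_ge0 ?l2norm_ge0//.
have Vin g : Vf g \in @ell2_pred X R.
  by rewrite unfold_in; apply: le_lt_trans (bnd g) _; rewrite ltry.
pose V g : H := Ell2 (Vin g).
have VE g x : V g x = l2dot g (T (xi R x)) by [].
have Vbnd g : l2norm (V g) <= M * l2norm g.
  rewrite -(@ler_pXn2r _ 2)// ?nnegrE ?mulr_ge0 ?l2norm_ge0//.
  by rewrite -lee_fin sqr_l2norm exprMn; exact: bnd.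
have Vb : V \in bop_pred.
  apply/asboolP; split; last by exists M.
  move=> a f g; apply: ell2P => x.
  by rewrite ell2D ell2Z !VE linearDl/= linearZl_LR.
exists (Bop Vb) => f g /=.
apply/eqP; rewrite -subr_eq0; apply/eqP.
apply: (@functional_eq0 _ _ (fun f => l2dot (T f) g - l2dot f (V g))
  (M * l2norm g + l2norm (V g))) => [a u v|u|x].
- rewrite bop_linear 2!linearDl/= 2!linearZl_LR/=.
  by rewrite mulrBr opprD addrACA.
- apply: le_trans (le_normcD _ _) _; rewrite normcN mulrDl lerD//.
    apply: le_trans (l2dot_le _ _) _; rewrite mulrAC ler_wpM2r// l2norm_ge0//.
  by rewrite mulrC; exact: l2dot_le.
- by rewrite l2dot_xil VE -l2dotC subrr.
Qed.

Lemma is_adjoint_unique T S S' : is_adjoint T S -> is_adjoint T S' -> S = S'.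
Proof.
move=> h h'; apply: bopP => g; apply: ell2P => x.
by apply: (can_inj (@conjCK _)); rewrite -!l2dot_xil -h -h'.
Qed.

End bop.

Section wot.
Variables (X : choiceType) (R : realType).
Local Notation C := R[i].
Local Notation H := (ell2 X R).
Local Notation B := (bop X R).

(* The weak operator topology is the coarsest topology on B(H) for which all
   the maps T |-> <T f, g> are continuous. *)
Definition matrix_coefficients (T : B) : {ptws H * H -> C^o} :=
  fun p => l2dot (T p.1) p.2.

Definition wot : topologicalType := initial_topology matrix_coefficients.

Definition wot_closure (S : set B) : set B := @closure wot S.

Lemma wot_closureP (S : set B) (T : B) :
  wot_closure S T <-> forall (s : seq (H * H)) (e : R), 0 < e ->
    exists2 A, S A &
      forall p, p \in s -> normc (l2dot (A p.1) p.2 - l2dot (T p.1) p.2) < e.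
Proof.
split=> [clT s e e0|hT].
  have coefc p : {for (T : wot), continuous (fun A : wot => (l2dot ((A : B) p.1) p.2 : C^o))}.
    have c1 : {for (T : wot), continuous (matrix_coefficients : wot -> _)}.
      exact: initial_continuous.
    apply: (@continuous_comp wot _ C^o (matrix_coefficients : wot -> {ptws H * H -> C^o})
      (fun h : {ptws H * H -> C^o} => h p)).
      exact: c1.
    exact: proj_continuous.
  have : nbhs (T : wot) [set A : wot | forall p, p \in s ->
      normc (l2dot ((A : B) p.1) p.2 - l2dot (T p.1) p.2) < e].
    elim: s => [|q s IH]; first by apply: filterS filterT => A _ p; rewrite in_nil.
    have e0C : (0 : C) < e%:C%C by rewrite ltcR.
    have := coefc q => /cvgrPdist_lt /(_ _ e0C) hq.
    apply: filterS2 IH hq => A hA hq p; rewrite in_cons => /predU1P[->|/hA//].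
    move: hq; rewrite -[ `|_|]/((normc _)%:C%C) ltcR -normcN opprB; exact.
  move=> /clT[A [SA hA]]; by exists A.
pose D : set (seq (H * H) * R) := [set se | 0 < se.2].
pose N (se : seq (H * H) * R) : set wot := [set A : wot | S A /\
  forall p, p \in se.1 -> normc (l2dot ((A : B) p.1) p.2 - l2dot (T p.1) p.2) < se.2].
have FF : Filter (filter_from D N).
  apply: filter_from_filter; first by exists ([::], 1); exact: ltr01.
  move=> [s1 e1] [s2 e2] /= e10 e20; exists (s1 ++ s2, Num.min e1 e2).
    by rewrite /D /= lt_min e10.
  move=> A [SA hA]; split; split => // p ps.
    have /hA : p \in s1 ++ s2 by rewrite mem_cat ps.
    by rewrite lt_min => /andP[].
  have /hA : p \in s1 ++ s2 by rewrite mem_cat ps orbT.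
  by rewrite lt_min => /andP[].
have cvgF : (matrix_coefficients : wot -> {ptws H * H -> C^o}) @ filter_from D N
    --> (matrix_coefficients T : {ptws H * H -> C^o}).
  apply/cvg_sup => p U [V] [[W] oW <-] WT WU; apply: (filterS WU).
  have : nbhs (matrix_coefficients T p : C^o) W by exact: open_nbhs_nbhs.
  move=> /nbhs_ballP[e /= e0 eW].
  have er : e = (complex.Re e)%:C%C.
    by rewrite RRe_real// gtr0_real.
  exists ([:: p], complex.Re e); first by move: e0; rewrite er ltcR.
  move=> A [SA /(_ p)]; rewrite mem_head => /(_ isT) hA.
  apply: eW; rewrite -ball_normE /= er distrC.
  by rewrite -[ `|_|]/((normc _)%:C%C) ltcR.
move=> Q [/= V [[W oW <-] WT] WQ].
have : filter_from D N (matrix_coefficients @^-1` W).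
  by apply: cvgF; exact: open_nbhs_nbhs.
move=> [[s e] e0 NW]; have [A SA hA] := hT s e e0.
by exists A; split => //; apply: WQ; apply: NW; split.
Qed.

End wot.

(* Vertices and edges form arbitrary sets: classically every type is a
   choiceType. An edge [e] is an arrow from [src e] to [rng e]. *)
Record digraph := Digraph {
  vertex : choiceType;
  edge : choiceType;
  src : edge -> vertex;
  rng : edge -> vertex
}.

Section paths.
Variable G : digraph.
Implicit Types (x : vertex G) (e : edge G).

(* The path e_1 e_2 ... e_n is encoded by the pair (r(e_1), [e_1; ...; e_n]), with
   s(e_j) = r(e_(j+1)), so that e_n is travelled first; the vertex x is encoded
   by (x, []). *)
Definition is_path (p : vertex G * seq (edge G)) : bool :=
  if p.2 is e :: es then (rng e == p.1) && path (fun e f => src e == rng f) e es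
  else true.

Definition dipath := {p : vertex G * seq (edge G) | is_path p}.
Implicit Types p q w : dipath.

Definition edges p : seq (edge G) := (val p).2.
Definition path_rng p : vertex G := (val p).1.
Definition path_src p : vertex G := last (path_rng p) [seq src e | e <- edges p].

Definition vpath x : dipath := Sub (x, [::]) isT.

Fact epath_subproof e : is_path (rng e, [:: e]).
Proof. by rewrite /is_path /= eqxx. Qed.
Definition epath e : dipath := Sub (rng e, [:: e]) (epath_subproof e).

(* the product pq; irrelevant default value p unless s(p) = r(q), see [val_pcat] *)
Definition pcat p q : dipath := insubd p (path_rng p, edges p ++ edges q).

Lemma path_src_vpath x : path_src (vpath x) = x. Proof. by []. Qed.
Lemma path_rng_vpath x : path_rng (vpath x) = x. Proof. by []. Qed.
Lemma path_src_epath e : path_src (epath e) = src e. Proof. by []. Qed.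
Lemma path_rng_epath e : path_rng (epath e) = rng e. Proof. by []. Qed.

Lemma val_pcat p q : path_src p = path_rng q ->
  val (pcat p q) = (path_rng p, edges p ++ edges q).
Proof.
move=> pq; rewrite val_insubd ifT//.
case: p q pq => [[x es] hp] [[y fs] hq]; rewrite /path_src /path_rng /edges /=.
case: es hp => [|e es] /= hp xy; first by rewrite xy.
move: hp; rewrite /is_path /= => /andP[-> ep]; rewrite cat_path ep /=.
case: fs hq => // f fs; rewrite /is_path /= => /andP[/eqP rf ->].
by rewrite rf -xy last_map eqxx.
Qed.

Lemma pcat_vpath x w : x = path_rng w -> pcat (vpath x) w = w.
Proof.
by move=> xw; apply: val_inj; rewrite val_pcat// xw; case: (w) => -[].
Qed.

Lemma pcatI p q q' : path_src p = path_rng q -> path_src p = path_rng q' ->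
  pcat p q = pcat p q' -> q = q'.
Proof.
move=> pq pq' /(congr1 val); rewrite !val_pcat// => -[/eqP].
rewrite eqseq_cat// eqxx /= => /eqP E; apply: val_inj.
move: pq pq' E; rewrite /path_rng /edges => ->.
by case: q q' => [[x s] ?] [[y t] ?] /= -> ->.
Qed.

Definition strongly_connected := forall x y,
  exists p, path_src p = x /\ path_rng p = y.

(* The graph consists exactly of the n vertices v_j and of the n edges e_j. Indices
   run over 0, ..., n-1 and [ordS] is the successor modulo n. *)
Definition circle_graph (n : nat) := (0 < n)%N /\
  exists v : 'I_n -> vertex G, exists e : 'I_n -> edge G,
    [/\ bijective v, bijective e &
        forall j, rng (e j) = v j /\ src (e j) = v (ordS j)].

End paths.

Section graph_algebra.
Variables (R : realType) (G : digraph).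
Local Notation C := R[i].
Local Notation H := (ell2 (dipath G) R).
Local Notation B := (bop (dipath G) R).
Local Notation xi := (@xi (dipath G) R).

Definition left_mult (p : dipath G) (T : B) := forall w,
  T (xi w) = if path_src p == path_rng w then xi (pcat p w) else 0.

(* Existence is [LopP], uniqueness is [left_mult_unique]; [L_vertex_xi] and
   [L_edge_xi] specialise the formula to paths of length 0 and 1. *)
Definition Lop (p : dipath G) : B := xget 0 [set T | left_mult p T].

Lemma LopP p : left_mult p (Lop p).
Proof.
suff [S hS] : exists S, left_mult p S.
  exact: (@xgetPex _ 0 [set T | left_mult p T] (ex_intro _ S hS)).
pose U := [set u | exists w, path_src p = path_rng w /\ pcat p w = u].
pose phi u : dipath G := xget p [set w | path_src p = path_rng w /\ pcat p w = u].
have phiP u : U u -> path_src p = path_rng (phi u) /\ pcat p (phi u) = u.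
  by move=> Uu; exact: (@xgetPex _ p [set w | _ /\ _] Uu).
have phiK w : path_src p = path_rng w -> phi (pcat p w) = w.
  move=> pw; have [h1 h2] : path_src p = path_rng (phi (pcat p w)) /\
      pcat p (phi (pcat p w)) = pcat p w by apply: phiP; exists w.
  exact: pcatI h2.
pose T0 (f : H) u : C := if u \in U then f (phi u) else 0.
have nz : normc (0 : C) = 0 by exact: normc0.
have T0le f : (sqsum (T0 f) <= sqsum f)%E.
  have -> : sqsum (T0 f) = \esum_(u in U) (normc (f (phi u)) ^+ 2)%:E.
    rewrite [RHS]esum_mkcond; apply: eq_esum => u _; rewrite /T0.
    by case: ifP => //; rewrite nz expr0n.
  rewrite -(@reindex_esum _ _ _ U (phi @` U) phi (fun w => (normc (f w) ^+ 2)%:E)).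
  - rewrite /sqsum [leRHS](esumID (phi @` U)) ?setTI; last first.
      by move=> w _; rewrite lee_fin sqr_ge0.
    by rewrite leeDl// esum_ge0// => w _; rewrite lee_fin sqr_ge0.
  - split=> [u Uu|u u' /set_mem Uu /set_mem Uu' E|//]; first by exists u.
    by rewrite -(phiP u Uu).2 E (phiP u' Uu').2.
have T0in f : T0 f \in @ell2_pred (dipath G) R.
  by rewrite unfold_in; apply: le_lt_trans (T0le f) _; case: f.
pose T f : H := Ell2 (T0in f).
have Tin : T \in @bop_pred (dipath G) R.
  apply/asboolP; split.
    move=> a f g; apply: ell2P => u; rewrite ell2D ell2Z /= /T0.
    by case: ifP; rewrite ?mulr0 ?addr0.
  exists 1 => f; rewrite mul1r -(@ler_pXn2r _ 2)// ?nnegrE ?l2norm_ge0//.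
  by rewrite -lee_fin !sqr_l2norm; exact: T0le.
exists (Bop Tin) => w; apply: ell2P => u /=; rewrite /T0 xiE.
case: ifPn => [/set_mem Uu|nUu].
  have [h1 h2] := phiP u Uu.
  have [pw|npw] := eqVneq (path_src p) (path_rng w).
    rewrite xiE; congr (_%:R); congr nat_of_bool.
    by apply/eqP/eqP => [<-//|->]; rewrite phiK.
  rewrite (_ : (phi u == w) = false)//.
  by apply: contraNF npw => /eqP <-; exact/eqP.
have [pw|//] := eqVneq (path_src p) (path_rng w).
rewrite xiE (_ : (u == _) = false)//.
by apply: contraNF nUu => /eqP ->; apply: mem_set; exists w.
Qed.

Lemma left_mult_unique p S T : left_mult p S -> left_mult p T -> S = T.
Proof. by move=> hS hT; apply: bop_eq_xi => w; rewrite hS hT. Qed.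

Definition L_vertex (x : vertex G) : B := Lop (vpath x).
Definition L_edge (e : edge G) : B := Lop (epath e).

Lemma L_edge_xi e w : L_edge e (xi w) =
  if path_rng w == src e then xi (pcat (epath e) w) else 0.
Proof. by rewrite LopP eq_sym. Qed.

Lemma L_vertex_xi x w : L_vertex x (xi w) = if path_rng w == x then xi w else 0.
Proof.
by rewrite LopP eq_sym; case: eqP => // wx; rewrite pcat_vpath.
Qed.

Definition subalgebra (S : set B) := [/\ S 0,
  forall a A A', S A -> S A' -> S (a *: A + A') &
  forall A A', S A -> S A' -> S (bcomp A A')].

(* The identity is not imposed: it is the weak-operator limit of the finite sums
   of the projections L_x, hence belongs to the algebra anyway. *)
Definition semigroupoid_algebra : set B :=
  smallest [set S | subalgebra S /\ wot_closure S `<=` S]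
    (range L_edge `|` range L_vertex).

Definition semigroupoid_center : set B :=
  [set A | semigroupoid_algebra A /\
    forall A', semigroupoid_algebra A' -> bcomp A A' = bcomp A' A].

Definition is_isometry (U : B) := forall f, l2norm (U f) = l2norm f.

Definition averages : set (B -> B) := [set alpha | exists n (U : 'I_n -> B),
  [/\ (0 < n)%N, forall j, semigroupoid_algebra (U j) /\ is_isometry (U j) &
      alpha = fun A =>
        n%:R^-1 *: \sum_(j < n) bcomp (adjoint (U j)) (bcomp A (U j))]].

Definition average_orbit (A : B) : set B := [set alpha A | alpha in averages].

End graph_algebra.
Arguments semigroupoid_algebra : clear implicits.
Arguments semigroupoid_center : clear implicits.

(* Main.v *)
Require Import Defs.
From HB Require Import structures.
From mathcomp Require Import all_boot all_order all_algebra.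
From mathcomp Require Import finmap complex ring lra.
From mathcomp Require Import all_classical all_reals.
From mathcomp Require Import ereal topology normedtype esum.
Import Order.TTheory GRing.Theory Num.Theory.
Import ComplexField.Normc.
Local Open Scope classical_set_scope.
Local Open Scope ring_scope.

Set Implicit Arguments.
Unset Strict Implicit.
Unset Printing Implicit Defensive.

(** Fix [A] in the algebra. An isometry [U] of the algebra that sends each basis
vector [xi w] to a basis vector compresses [A] to [U^* A U], whose matrix entry
at [(p, q)] is that of [A] at the images of [p] and [q]. Operators of the
algebra commute with the right multiplications [xi w |-> xi (w p)], so their
matrices are triangular: an entry at [(p, q)] can be nonzero only if [q = w p]
for some path [w], and the entry at [(p, p)] depends only on the range of [p]
([algebra_entry_neq0], [algebra_diag]).

If some vertex [v] emits two edges, strong connectedness yields two different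
closed walks at [v] of the same length, and so closed walks at [v] in great
variety. For a finite set [V] of vertices containing [v], one isometry [U]
prefixes every path with range [y] in [V] by a walk from [y] to [v] and leaves
the other paths alone. All these prefixes start with a long closed walk without
small periods, so two prefixed paths of bounded length are never left extensions
of each other, unless they are equal. Hence on any given finite set of basis
vectors the matrix of [U^* A U] is that of the scalar [<A xi_v, xi_v>]
([closure_orbit_scalar]). Compressions of [A] by isometries have norm at most
that of [A], and on bounded sets the weak operator topology is entrywise
convergence ([wot_closure_xi]); so this scalar operator, which is central, is a
weak limit of elements [U^* A U].

Otherwise distinct edges have distinct sources. If there is no edge at all, the
space has dimension at most one and [A] itself is central. If there is one, the
graph is one cycle ([cycle_structure]). Let [S] be the isometry of the
algebra that prolongs every path by the unique possible edge. Averaging with the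
symmetries [1 - 2 L_x] first makes [A] commute with the vertex projections
([orbit_commute_vertices]). Compression by [S] is an endomorphism of the algebra,
and its [n]-th iterate fixes [A] because [S ^+ n] is central when [n] is the
length of the cycle; the mean over one period of the iterates then commutes with
[S] as well. Vertex projections and [S] generate the algebra, so that the result
is central: here the orbit itself meets the center
([orbit_meets_center_cycle]). *)

(** * Operators on the Hilbert space as a ring *)

Section operators.
Variables (X : choiceType) (R : realType).
Local Notation C := R[i].
Local Notation H := (ell2 X R).
Local Notation B := (bop X R).
Local Notation xi := (@xi X R).
Implicit Types (S T U : B) (f g : H).

Fact id_in : (id : H -> H) \in @bop_pred X R.
Proof. by apply/asboolP; split=> //; exists 1 => f; rewrite mul1r. Qed.

Definition bop_id : B := Bop id_in.

Fact bcompA : associative (@bcomp X R).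
Proof. by move=> S T U; apply: bopP. Qed.
Fact bcomp1l : left_id bop_id (@bcomp X R).
Proof. by move=> T; apply: bopP. Qed.
Fact bcomp1r : right_id bop_id (@bcomp X R).
Proof. by move=> T; apply: bopP. Qed.
Fact bcompDl : left_distributive (@bcomp X R) +%R.
Proof. by move=> S T U; apply: bopP. Qed.
Fact bopfD T f g : T (f + g) = T f + T g.
Proof. by rewrite -[f in LHS]scale1r bop_linear scale1r. Qed.
Fact bcompDr : right_distributive (@bcomp X R) +%R.
Proof. by move=> S T U; apply: bopP => f; rewrite /= bopfD. Qed.

(** Composition is made the multiplication of a ring, so that the operator
identities below can be handled by the generic theory of rings. The ring may be
trivial, since the index set may be empty. *)
HB.instance Definition _ := GRing.Zmodule_isPzRing.Build (bop X R)
  bcompA bcomp1l bcomp1r bcompDl bcompDr.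

Lemma bcompE S T : bcomp S T = S * T. Proof. by []. Qed.
Lemma bopM S T f : (S * T) f = S (T f). Proof. by []. Qed.
Lemma bop1 f : (1 : B) f = f. Proof. by []. Qed.

Lemma bopfZ T a f : T (a *: f) = a *: T f.
Proof. by rewrite -[a *: f]addr0 bop_linear bop0 addr0. Qed.

Lemma bopfB T f g : T (f - g) = T f - T g.
Proof. by rewrite bopfD -scaleN1r bopfZ scaleN1r. Qed.

Lemma bop_sumE (I : Type) (s : seq I) (F : I -> B) f :
  (\sum_(i <- s) F i) f = \sum_(i <- s) F i f.
Proof. by elim/big_rec2: _ => // i u v _ <-. Qed.

Lemma scale_bopl a S T : (a *: S) * T = a *: (S * T).
Proof. exact: bopP. Qed.

Lemma scale_bopr a S T : S * (a *: T) = a *: (S * T).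
Proof. by apply: bopP => f; exact: bopfZ. Qed.

Lemma l2dot_xi2 x y : l2dot (xi x) (xi y) = (x == y)%:R.
Proof. by rewrite l2dot_xi xiE eq_sym. Qed.

Lemma l2norm_sq_inj f g : l2dot f f = l2dot g g -> l2norm f = l2norm g.
Proof.
rewrite !l2dotff => /complexI fg.
by apply: (@pexpIrn _ 2); rewrite ?nnegrE ?l2norm_ge0.
Qed.

Lemma bop_eq_dot S T :
  (forall x y, l2dot (S (xi x)) (xi y) = l2dot (T (xi x)) (xi y)) -> S = T.
Proof.
by move=> ST; apply: bop_eq_xi => x; apply: ell2P => y; rewrite -!l2dot_xi.
Qed.

Lemma adjointE T f g : l2dot (adjoint T f) g = l2dot f (T g).
Proof. by rewrite l2dotC -adjointP -l2dotC. Qed.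

Lemma adjoint_eq T S : is_adjoint T S -> adjoint T = S.
Proof. exact/is_adjoint_unique/adjointP. Qed.

Lemma adjointM S T : adjoint (S * T) = adjoint T * adjoint S.
Proof. by apply: adjoint_eq => f g; rewrite !bopM -!adjointP. Qed.

Lemma adjoint_id : adjoint (1 : B) = 1.
Proof. by apply: adjoint_eq. Qed.

Lemma adjoint_eq_xi T S :
  (forall x y, l2dot (T (xi x)) (xi y) = l2dot (xi x) (S (xi y))) ->
  adjoint T = S.
Proof.
move=> TS; apply: bop_eq_dot => x y.
by rewrite adjointE l2dotC TS -l2dotC.
Qed.

Lemma isometry_xi U :
  (forall x y, l2dot (U (xi x)) (U (xi y)) = (x == y)%:R) ->
  adjoint U * U = 1.
Proof.
move=> Uxi; apply: bop_eq_dot => x y.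
by rewrite bopM adjointE Uxi bop1 l2dot_xi2.
Qed.

Lemma isometry_norm U : adjoint U * U = 1 -> {mono U : f / l2norm f}.
Proof.
by move=> UU f; apply: l2norm_sq_inj; rewrite adjointP -bopM UU.
Qed.

(** [|T f|^2 = <T f, f>] for a projection, and Cauchy-Schwarz applies. *)
Lemma projection_le T f : adjoint T = T -> T * T = T ->
  l2norm (T f) <= l2norm f.
Proof.
move=> Ts TT.
have E : l2dot (T f) (T f) = l2dot f (T f) by rewrite adjointP Ts -bopM TT.
have [->|Tf0] := eqVneq (l2norm (T f)) 0; first exact: l2norm_ge0.
have Tf_gt0 : 0 < l2norm (T f) by rewrite lt_def Tf0 l2norm_ge0.
rewrite -(ler_pM2r Tf_gt0).
have := l2dot_le f (T f); rewrite -E l2dotff normc_real ger0_norm ?sqr_ge0//.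
Qed.

(** Compressing by an isometry does not increase the norm, since
[|h|^2 = <T U f, U h>] for [h = U^* T U f]. *)
Lemma adjoint_isometry_le U T M f :
  {mono U : f / l2norm f} ->
  (forall g, l2norm (T g) <= M * l2norm g) ->
  l2norm ((adjoint U * (T * U)) f) <= M * l2norm f.
Proof.
move=> hU hT; set h := _ f.
have [->|h0] := eqVneq (l2norm h) 0.
  by rewrite -hU; apply: le_trans (hT _); exact: l2norm_ge0.
have h_gt0 : 0 < l2norm h by rewrite lt_def h0 l2norm_ge0.
rewrite -(ler_pM2r h_gt0).
have : l2dot h h = l2dot (T (U f)) (U h) by rewrite {1}/h !bopM adjointE.
rewrite l2dotff => /(congr1 (@normc R)); rewrite normc_real ger0_norm ?sqr_ge0//.
rewrite -expr2 => ->; apply: le_trans (l2dot_le _ _) _.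
by rewrite hU ler_wpM2r ?l2norm_ge0// -(hU f) hT.
Qed.

(** The use of such a pullback is its adjoint, which sends [xi u] to [xi (phi u)]
for [u] in [D] and kills the other basis vectors. Injectivity makes the pullback
a contraction. *)
Lemma pullback_exists (D : set X) (phi : X -> X) : {in D &, injective phi} ->
  exists T, forall f u, T f u = if u \in D then f (phi u) else 0.
Proof.
move=> phi_inj.
pose T0 f u : C := if u \in D then f (phi u) else 0.
have nz : normc (0 : C) = 0 by exact: normc0.
have T0le f : (sqsum (T0 f) <= sqsum f)%E.
  have -> : sqsum (T0 f) = \esum_(u in D) (normc (f (phi u)) ^+ 2)%:E.
    rewrite [RHS]esum_mkcond; apply: eq_esum => u _; rewrite /T0.
    by case: ifP => //; rewrite nz expr0n.
  rewrite -(@reindex_esum _ _ _ D (phi @` D) phi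
    (fun w => (normc (f w) ^+ 2)%:E)).
  - rewrite /sqsum [leRHS](esumID (phi @` D)) ?setTI; last first.
      by move=> w _; rewrite lee_fin sqr_ge0.
    by rewrite leeDl// esum_ge0// => w _; rewrite lee_fin sqr_ge0.
  - by split=> [u Du|u u' uD u'D E|//]; [exists u|exact: phi_inj].
have T0in f : T0 f \in @ell2_pred X R.
  by rewrite unfold_in; apply: le_lt_trans (T0le f) _; case: f.
pose T f : H := Ell2 (T0in f).
have Tin : T \in @bop_pred X R.
  apply/asboolP; split.
    move=> a f g; apply: ell2P => u; rewrite ell2D ell2Z /= /T0.
    by case: ifP; rewrite ?mulr0 ?addr0.
  exists 1 => f; rewrite mul1r -(@ler_pXn2r _ 2)// ?nnegrE ?l2norm_ge0//.
  by rewrite -lee_fin !sqr_l2norm; exact: T0le.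
by exists (Bop Tin).
Qed.

End operators.

(** * The weak operator topology *)

Section weak_closure.
Variables (X : choiceType) (R : realType).
Local Notation C := R[i].
Local Notation H := (ell2 X R).
Local Notation B := (bop X R).
Local Notation xi := (@xi X R).
Implicit Types (S T U P Q : B) (f g : H) (E : set B).

(** Left and right multiplication by fixed operators are weak-operator
continuous, since [<P T Q f, g> = <T (Q f), P^* g>]. *)
Lemma wot_closure_mul E T P Q :
  wot_closure E T -> wot_closure [set P * (A * Q) | A in E] (P * (T * Q)).
Proof.
move=> /wot_closureP ET; apply/wot_closureP => s e e0.
have [A EA hA] := ET [seq (Q p.1, adjoint P p.2) | p <- s] e e0.
exists (P * (A * Q)); first by exists A.
move=> p ps; rewrite !bopM !(adjointP P).
exact: hA (map_f (fun p => (Q p.1, adjoint P p.2)) ps).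
Qed.

(** Commutation with a fixed operator and invariance of a subspace take this form,
so that they define weakly closed sets of operators. *)
Lemma wot_closure_eq E T P Q P' Q' : wot_closure E T ->
  (forall A, E A -> P * (A * Q) = P' * (A * Q')) -> P * (T * Q) = P' * (T * Q').
Proof.
move=> /wot_closureP ET hE; apply: bop_eq_dot => x y.
apply/eqP; rewrite -subr_eq0; apply/eqP/eq0_normc/eqP.
rewrite eq_le normc_ge0 andbT; apply/ler_addgt0Pr => e e0; rewrite add0r.
have e20 : 0 < e / 2 by rewrite divr_gt0.
have [A EA hA] := ET [:: (Q (xi x), adjoint P (xi y));
  (Q' (xi x), adjoint P' (xi y))] (e / 2) e20.
have hA' f g : (f, g) \in [:: (Q (xi x), adjoint P (xi y));
    (Q' (xi x), adjoint P' (xi y))] ->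
    normc (l2dot (A f) g - l2dot (T f) g) < e / 2 by exact: hA (f, g).
have h1 := hA' _ _ (mem_head _ _).
have h2 : normc (l2dot (A (Q' (xi x))) (adjoint P' (xi y)) -
    l2dot (T (Q' (xi x))) (adjoint P' (xi y))) < e / 2.
  by apply: hA'; rewrite !inE eqxx orbT.
have EA' : l2dot (A (Q (xi x))) (adjoint P (xi y)) =
    l2dot (A (Q' (xi x))) (adjoint P' (xi y)).
  by rewrite -!adjointP -!bopM -!mulrA hE.
rewrite -EA' in h2; rewrite !bopM (adjointP P) (adjointP P').
move: h1 h2; set a := l2dot (A _) _; set t := l2dot _ _.
set t' := l2dot _ _ => h1 h2.
have -> : t - t' = - (a - t) + (a - t') by ring.
apply: le_trans (le_normcD _ _) _; rewrite normcN [leRHS]splitr.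
exact: lerD (ltW h1) (ltW h2).
Qed.

(** Both vectors are replaced by finite combinations of basis vectors; the error
is bounded by the norm bound [K], uniformly in [T]. *)
Lemma small_coefficient f g (K e : R) : 0 < e -> exists F : seq X,
  forall T, (forall h, l2norm (T h) <= K * l2norm h) ->
    {in F &, forall x y, l2dot (T (xi x)) (xi y) = 0} ->
    normc (l2dot (T f) g) < e.
Proof.
move=> e0.
(* [c] exceeds the factor of [d] in the error, and [d * c < d * (c + e) = e]. *)
pose c := (`|K| + 1) * (l2norm f + l2norm g + 1).
have f0 := l2norm_ge0 f; have g0 := l2norm_ge0 g.
have c0 : 0 < c by rewrite mulr_gt0// ltr_wpDl// addr_ge0.
pose d := e / (c + e).
have d0 : 0 < d by rewrite /d divr_gt0// addr_gt0.
have [F hF] := ell2_approx f d0; have [G hG] := ell2_approx g d0.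
exists (F ++ G : seq X) => T hT T0.
set f' := \sum_(x <- F) _ in hF; set g' := \sum_(x <- G) _ in hG.
have T'0 : l2dot (T f') g' = 0.
  rewrite /f' /g' bop_sum linear_sumlz big_seq big1// => x xF.
  rewrite linear_sumr big_seq big1// => y yG.
  by rewrite linearZl_LR linearZr_LR/= T0 ?mulr0// mem_cat ?xF ?yG ?orbT.
have -> : l2dot (T f) g = l2dot (T (f - f')) g + l2dot (T f') (g - g').
  by rewrite bopfB linearBl /= linearBr /= T'0 subr0 subrK.
have d1 : d < 1 by rewrite /d ltr_pdivrMr ?mul1r ?ltrDr ?addr_gt0.
have hT' h : l2norm (T h) <= `|K| * l2norm h.
  by apply: le_trans (hT h) _; rewrite ler_wpM2r ?l2norm_ge0 ?ler_norm.
have f'le : l2norm f' <= l2norm f + 1.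
  have -> : f' = f - (f - f') by rewrite subKr.
  by apply: le_trans (l2normD _ _) _; rewrite l2normN lerD2l; lra.
have K0 := normr_ge0 K.
have b1 : normc (l2dot (T (f - f')) g) <= `|K| * d * l2norm g.
  apply: le_trans (l2dot_le _ _) _; rewrite ler_wpM2r//.
  by apply: le_trans (hT' _) _; rewrite ler_wpM2l.
have b2 : normc (l2dot (T f') (g - g')) <= `|K| * (l2norm f + 1) * d.
  apply: le_trans (l2dot_le _ _) _; apply: ler_pM; rewrite ?l2norm_ge0//.
  by apply: le_trans (hT' _) _; rewrite ler_wpM2l.
apply: le_lt_trans (le_normcD _ _) _; apply: le_lt_trans (lerD b1 b2) _.
have -> : `|K| * d * l2norm g + `|K| * (l2norm f + 1) * d =
  d * (c - (l2norm f + l2norm g + 1)) by rewrite /c; ring.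
have ce : d * (c + e) = e by rewrite /d divfK// gt_eqF// addr_gt0.
nra.
Qed.

(** On bounded sets the weak-operator topology is that of convergence of the
matrix entries, because the basis spans a dense subspace. *)
Lemma wot_closure_xi E T (M : R) :
  (forall F : seq X, exists A, [/\ E A,
    forall f, l2norm (A f) <= M * l2norm f &
    {in F &, forall x y, l2dot (A (xi x)) (xi y) = l2dot (T (xi x)) (xi y)}]) ->
  wot_closure E T.
Proof.
move=> hE; apply/wot_closureP => s e e0.
have [N hN] := bop_bounded T.
have [F hF] : exists F : seq X, forall A,
    (forall h, l2norm ((A - T) h) <= (M + N) * l2norm h) ->
    {in F &, forall x y, l2dot ((A - T) (xi x)) (xi y) = 0} ->
    forall p, p \in s -> normc (l2dot ((A - T) p.1) p.2) < e.
  elim: s => [|p s [F hF]]; first by exists [::].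
  have [G hG] := small_coefficient p.1 p.2 (M + N) e0.
  exists (G ++ F) => A bA A0 q; rewrite inE => /predU1P[->|qs].
    by apply: hG => // x y xG yG; apply: A0; rewrite mem_cat ?xG ?yG.
  by apply: hF => // x y xF yF; apply: A0; rewrite mem_cat ?xF ?yF orbT.
have [A [EA bA AT]] := hE F; exists A => // p ps.
have dB f g : l2dot ((A - T) f) g = l2dot (A f) g - l2dot (T f) g.
  by rewrite -[(A - T) f]/(A f - T f) linearBl.
rewrite -dB; apply: (hF A _ _ p ps) => [h|x y xF yF].
  rewrite -[(A - T) h]/(A h - T h); apply: le_trans (l2normD _ _) _.
  by rewrite l2normN mulrDl; exact: lerD (bA h) (hN h).
by rewrite dB AT// subrr.
Qed.

End weak_closure.

(** * Paths, and the matrix of an operator of the algebra *)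

Section paths.
Variable G : digraph.
Implicit Types (x y : vertex G) (e : edge G) (p q w : dipath G).

Lemma dipath_eq p q : path_rng p = path_rng q -> edges p = edges q -> p = q.
Proof.
by case: p q => [[x s] ?] [[y t] ?] /= E1 E2; apply: val_inj; congr (_, _).
Qed.

Lemma rng_pcat p q : path_src p = path_rng q ->
  path_rng (pcat p q) = path_rng p.
Proof. by move=> pq; rewrite /path_rng val_pcat. Qed.

Lemma edges_pcat p q : path_src p = path_rng q ->
  edges (pcat p q) = edges p ++ edges q.
Proof. by move=> pq; rewrite /edges val_pcat. Qed.

Lemma src_pcat p q : path_src p = path_rng q ->
  path_src (pcat p q) = path_src q.
Proof.
move=> pq; rewrite {1}/path_src edges_pcat// rng_pcat// map_cat last_cat.
by rewrite -/(path_src p) pq.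
Qed.

Lemma pcatA p q w : path_src p = path_rng q -> path_src q = path_rng w ->
  pcat p (pcat q w) = pcat (pcat p q) w.
Proof.
move=> pq qw; apply: dipath_eq.
  by rewrite !rng_pcat ?src_pcat ?rng_pcat.
by rewrite !edges_pcat ?src_pcat ?rng_pcat// catA.
Qed.

(** The first edge of [s] is travelled last, as in a path, so that [y] is the range
and [x] the source. Walks are concatenated as plain sequences of edges, whereas
the product of paths needs its composability condition at every use. *)
Fixpoint walk y (s : seq (edge G)) x : bool :=
  if s is e :: s' then (rng e == y) && walk (src e) s' x else y == x.

Lemma walk_cat z s y t x : walk z s y -> walk y t x -> walk z (s ++ t) x.
Proof.
by elim: s z => [z /eqP ->//|e s IH z /= /andP[-> /IH]]; exact.
Qed.

Lemma walk_edges p : walk (path_rng p) (edges p) (path_src p).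
Proof.
case: p => [[y s] hs]; rewrite /path_src /path_rng /edges /= in hs *.
case: s hs => [|e s]; rewrite /is_path //= => /andP[-> hs] /=.
by elim: s e hs => [|f s IH] e //= /andP[/eqP <- hs]; rewrite eqxx IH.
Qed.

Lemma walk_dipath y s x : walk y s x ->
  exists p, [/\ path_rng p = y, path_src p = x & edges p = s].
Proof.
elim: s y => [y /eqP <-|e s IH y /= /andP[/eqP <- /IH[p [py px ps]]]].
  by exists (vpath y).
by exists (pcat (epath e) p); rewrite rng_pcat ?src_pcat ?edges_pcat ?ps.
Qed.

Lemma strongly_connected_walk x y : strongly_connected G ->
  exists s, walk y s x.
Proof.
by move=> /(_ x y)[p [<- <-]]; exists (edges p); exact: walk_edges.
Qed.

End paths.

Section algebra.
Variables (R : realType) (G : digraph).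
Local Notation C := R[i].
Local Notation H := (ell2 (dipath G) R).
Local Notation B := (bop (dipath G) R).
Local Notation xi := (@xi (dipath G) R).
Local Notation L := (semigroupoid_algebra R G).
Local Notation Lv := (@L_vertex R G).
Local Notation Le := (@L_edge R G).
Implicit Types (S T U A : B) (x y : vertex G) (e : edge G).
Implicit Types (p q w : dipath G).

(** Induction on the algebra as the smallest weakly closed one. *)
Lemma algebra_subset (E : set B) : subalgebra E -> wot_closure E `<=` E ->
  (forall e, E (Le e)) -> (forall x, E (Lv x)) -> L `<=` E.
Proof.
move=> algE clE Ee Ex; apply: smallest_sub; first by split.
by move=> _ [[e _ <-]|[x _ <-]].
Qed.

Lemma algebra_subalgebra : subalgebra L.
Proof.
split=> [|a A A' hA hA'|A A' hA hA'] E hE.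
- by case: hE => -[[]].
- by case: (hE) => -[[_ Elin _] _] _; apply: Elin; [exact: hA|exact: hA'].
- by case: (hE) => -[[_ _ Emul] _] _; apply: Emul; [exact: hA|exact: hA'].
Qed.

Lemma algebra_closed : wot_closure L `<=` L.
Proof.
move=> T clT E hE; case: (hE) => -[_ clE] _; apply: clE.
by apply: closureS clT => A; exact.
Qed.

Lemma algebra0 : L 0. Proof. by have [] := algebra_subalgebra. Qed.
Lemma algebraM S T : L S -> L T -> L (S * T).
Proof. by have [_ _] := algebra_subalgebra; exact. Qed.
Lemma algebraD S T : L S -> L T -> L (S + T).
Proof.
have [_ + _] := algebra_subalgebra => h LS LT.
by rewrite -[S]scale1r; exact: h.
Qed.
Lemma algebraZ a T : L T -> L (a *: T).
Proof.
have [h0 h _] := algebra_subalgebra => LT.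
by rewrite -[a *: T]addr0; exact: h.
Qed.
Lemma algebraB S T : L S -> L T -> L (S - T).
Proof.
by move=> LS LT; rewrite -scaleN1r; exact: algebraD LS (algebraZ _ LT).
Qed.
Lemma algebra_sum (I : eqType) (s : seq I) (F : I -> B) :
  {in s, forall i, L (F i)} -> L (\sum_(i <- s) F i).
Proof.
move=> LF; rewrite big_seq; apply: (big_ind L) => //.
- exact: algebra0.
- exact: algebraD.
Qed.
Lemma algebra_edge e : L (Le e).
Proof. by move=> E [_]; apply; left; exists e. Qed.
Lemma algebra_vertex x : L (Lv x).
Proof. by move=> E [_]; apply; right; exists x. Qed.

Lemma diagonal_selfadjoint T (P : pred (dipath G)) :
  (forall w, T (xi w) = if P w then xi w else 0) -> adjoint T = T.
Proof.
move=> hT; apply: adjoint_eq_xi => p q.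
rewrite !hT (fun_if (fun f => l2dot f (xi q))) (fun_if (l2dot (xi p))).
rewrite linear0l linear0r l2dot_xi2.
by case: eqVneq => [->|_]; rewrite ?if_same.
Qed.

Lemma diagonal_idem T (P : pred (dipath G)) :
  (forall w, T (xi w) = if P w then xi w else 0) -> T * T = T.
Proof.
move=> hT; apply: bop_eq_xi => p; rewrite bopM hT (fun_if (bop_val T)) bop0 hT.
by case: (P p).
Qed.

Lemma vertex_selfadjoint x : adjoint (Lv x) = Lv x.
Proof. exact: diagonal_selfadjoint (L_vertex_xi R x). Qed.

Lemma vertex_idem x : Lv x * Lv x = Lv x.
Proof. exact: diagonal_idem (L_vertex_xi R x). Qed.

Lemma vertex_comm x y : Lv x * Lv y = Lv y * Lv x.
Proof.
apply: bop_eq_xi => p.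
have E z (b : bool) : Lv z (if b then xi p else 0) =
    if b && (path_rng p == z) then xi p else 0.
  by case: b; rewrite ?bop0// L_vertex_xi.
by rewrite !bopM !L_vertex_xi !E andbC.
Qed.

Lemma sum_by_range_xi (V : seq (vertex G)) (T : vertex G -> B) w
    (g : vertex G -> H) : uniq V ->
  (forall x, T x (xi w) = if path_rng w == x then g x else 0) ->
  (\sum_(x <- V) T x) (xi w) =
    if path_rng w \in V then g (path_rng w) else 0.
Proof.
move=> uV hT; rewrite bop_sumE; have [wV|wV] := ifPn.
  rewrite (bigD1_seq (path_rng w))//= hT eqxx big1 ?addr0// => x /negPf xw.
  by rewrite hT eq_sym xw.
rewrite big1_seq// => x /andP[_ xV]; rewrite hT.
by case: eqP xV => // <-; rewrite (negPf wV).
Qed.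

Lemma sum_vertex_xi (V : seq (vertex G)) w : uniq V ->
  (\sum_(x <- V) Lv x) (xi w) = if path_rng w \in V then xi w else 0.
Proof.
move=> uV; apply: (sum_by_range_xi (g := fun=> xi w)) => // x.
exact: L_vertex_xi.
Qed.

(** The finite sums of vertex projections are contractions that fix more and
more basis vectors, hence they converge to the identity. *)
Lemma algebra1 : L 1.
Proof.
apply: algebra_closed; apply: (@wot_closure_xi _ _ _ _ 1) => F.
pose V := undup [seq path_rng w | w <- F].
have uV : uniq V by exact: undup_uniq.
exists (\sum_(x <- V) Lv x); split.
- by apply: algebra_sum => x _; exact: algebra_vertex.
- have E w := sum_vertex_xi w uV; move=> f; rewrite mul1r.
  by apply: projection_le; [exact: diagonal_selfadjoint E|
    exact: diagonal_idem E].
- move=> p q pF qF; rewrite sum_vertex_xi// mem_undup map_f//.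
Qed.

Lemma algebra_Lop p : L (Lop R p).
Proof.
case: p => [[y s] hs].
suff: forall p, edges p = s -> L (Lop R p) by apply.
elim: s {y hs} => [|e s IH] p ps.
  have -> : p = vpath (path_rng p) by exact: dipath_eq.
  exact: algebra_vertex.
have := walk_edges p; rewrite ps /= => /andP[/eqP re /walk_dipath[q [qr qs qe]]].
have -> : p = pcat (epath e) q.
  by apply: dipath_eq; rewrite ?rng_pcat ?edges_pcat ?qr ?ps ?qe.
suff -> : Lop R (pcat (epath e) q) = Le e * Lop R q.
  by apply: algebraM; [exact: algebra_edge|exact: IH].
apply: bop_eq_xi => w; rewrite bopM !LopP src_pcat ?qr//.
case: eqP => qw; last by rewrite bop0.
by rewrite L_edge_xi rng_pcat// qr eqxx pcatA// qr.
Qed.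

(** The commutant of an operator is a weakly closed algebra, so commuting with
the generators suffices. *)
Lemma algebra_commutant S : (forall e, Le e * S = S * Le e) ->
  (forall x, Lv x * S = S * Lv x) -> forall T, L T -> T * S = S * T.
Proof.
move=> hE hV; apply: algebra_subset => //.
- split=> [|a A A' hA hA'|A A' hA hA']; rewrite /= ?mul0r ?mulr0//.
    by rewrite mulrDl mulrDr hA' scale_bopl scale_bopr hA.
  by rewrite bcompE -mulrA hA' mulrA hA mulrA.
- move=> T clT.
  have := @wot_closure_eq _ _ _ T 1 S S 1 clT.
  by rewrite !mul1r !mulr1; apply => A hA; rewrite mul1r mulr1.
Qed.

Lemma center_scalar (a : C) : semigroupoid_center R G (a *: (1 : B)).
Proof.
split; first exact: algebraZ algebra1.
by move=> A _; rewrite !bcompE scale_bopl scale_bopr mul1r mulr1.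
Qed.

(** This is right multiplication by [p]. It is obtained as an adjoint, because its
own adjoint is a mere pullback of functions, which also shows what its range is
made of. *)
Lemma right_mult_exists p : exists S : B,
  (forall w, S (xi w) =
     if path_src w == path_rng p then xi (pcat w p) else 0) /\
  (forall f q, l2dot (S f) (xi q) != 0 ->
     exists2 w, path_src w = path_rng p & q = pcat w p).
Proof.
pose D := [set w | path_src w = path_rng p].
have Dinj : {in D &, injective (fun w => pcat w p)}.
  move=> w w' /set_mem wp /set_mem w'p E; apply: dipath_eq.
    by rewrite -(rng_pcat wp) E rng_pcat.
  have := congr1 (@edges G) E; rewrite !edges_pcat// => /eqP.
  rewrite eqseq_cat; first by move=> /andP[/eqP].
  have := congr1 (fun q => size (edges q)) E.
  by rewrite !edges_pcat// !size_cat => /addIn.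
have [T hT] := pullback_exists R Dinj.
exists (adjoint T); split=> [w|f q].
  apply: ell2P => q; rewrite -l2dot_xi adjointE l2dot_xil hT.
  have DE : (w \in D) = (path_src w == path_rng p).
    by apply/idP/eqP => [/set_mem//|wp]; exact/mem_set.
  rewrite DE; case: ifP => _; last by rewrite conjC0.
  by rewrite !xiE conjC_nat eq_sym.
rewrite adjointE; apply: contra_neqP => nq.
suff -> : T (xi q) = 0 by rewrite linear0r.
apply: ell2P => w; rewrite hT; case: ifPn => // /set_mem wp.
by rewrite xiE; case: eqP => // E; case: nq; exists w.
Qed.

(** Left and right multiplications commute on the basis by associativity of the
product of paths. *)
Lemma right_mult_comm p S : (forall w, S (xi w) =
    if path_src w == path_rng p then xi (pcat w p) else 0) ->
  forall T, L T -> T * S = S * T.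
Proof.
move=> hS; apply: algebra_commutant => [e|x]; apply: bop_eq_xi => w;
  rewrite !bopM hS.
  rewrite L_edge_xi; case: eqP => wp; case: eqP => we; rewrite ?bop0//.
  - by rewrite L_edge_xi rng_pcat// hS src_pcat// we wp !eqxx -pcatA.
  - by rewrite L_edge_xi rng_pcat//; case: eqP.
  - by rewrite hS src_pcat//; case: eqP.
rewrite L_vertex_xi; case: eqP => wp; case: eqP => wx; rewrite ?bop0//.
- by rewrite L_vertex_xi rng_pcat// hS wp wx !eqxx.
- by rewrite L_vertex_xi rng_pcat//; case: eqP.
- by rewrite hS; case: eqP.
Qed.

Lemma pcat_rng p : pcat (vpath (path_rng p)) p = p.
Proof. exact: pcat_vpath. Qed.

(** Since [xi p] is the image of a vertex vector under right multiplication by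
[p], the vector [T (xi p)] lies in the range of that right multiplication. *)
Lemma algebra_entry_neq0 T p q : L T -> l2dot (T (xi p)) (xi q) != 0 ->
  exists2 w, path_src w = path_rng p & q = pcat w p.
Proof.
move=> LT; have [S [hS supS]] := right_mult_exists p.
have -> : xi p = S (xi (vpath (path_rng p))).
  by rewrite hS path_src_vpath eqxx pcat_rng.
by rewrite -bopM (right_mult_comm hS LT) => /supS.
Qed.

(** Writing [xi p] as the image of [xi (vpath (path_rng p))] under right
multiplication by [p], whose adjoint sends [xi p] back to that vector, moves the
entry at [p] to the vertex. *)
Lemma algebra_diag T p : L T ->
  l2dot (T (xi p)) (xi p) =
  l2dot (T (xi (vpath (path_rng p)))) (xi (vpath (path_rng p))).
Proof.
move=> LT; have [S [hS _]] := right_mult_exists p.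
set v := vpath (path_rng p).
have pE : xi p = S (xi v) by rewrite hS path_src_vpath eqxx pcat_rng.
rewrite pE -bopM (right_mult_comm hS LT) bopM adjointP; congr (l2dot _ _).
apply: ell2P => w; rewrite -!l2dot_xi adjointE -pE hS l2dot_xi2.
case: eqP => wp; last first.
  rewrite linear0r; case: eqP => // vw.
  by case: wp; rewrite -vw path_src_vpath.
rewrite l2dot_xi2; congr (nat_of_bool _)%:R; apply/eqP/eqP => [E|<-]; last first.
  by rewrite pcat_rng.
have := congr1 (@edges G) E; rewrite edges_pcat// => /(congr1 size).
rewrite size_cat => /eqP; rewrite -{1}[size _]add0n eqn_add2r eq_sym => /nilP w0.
apply: dipath_eq; rewrite ?w0//.
by have := congr1 (@path_rng G) E; rewrite rng_pcat.
Qed.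

End algebra.

(** * Averages by isometries *)

Section averaging.
Variables (R : realType) (G : digraph).
Local Notation C := R[i].
Local Notation B := (bop (dipath G) R).
Local Notation xi := (@xi (dipath G) R).
Local Notation L := (semigroupoid_algebra R G).
Local Notation Lv := (@L_vertex R G).
Implicit Types (S T U A : B) (x y : vertex G).

(** General index types serve for the product types that arise when averages are
composed. *)
Lemma orbit_average (I : finType) (U : I -> B) A : (0 < #|I|)%N ->
  (forall i, L (U i)) -> (forall i, is_isometry (U i)) ->
  average_orbit A (#|I|%:R^-1 *: \sum_i adjoint (U i) * (A * U i)).
Proof.
move=> I0 LU isoU; eexists.
  exists #|I|, (U \o enum_val); split=> //.
  by move=> j; split; [exact: LU|exact: isoU].
by congr (_ *: _); rewrite [RHS](reindex _ (onW_bij _ (enum_val_bij I))).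
Qed.

Lemma orbit_conj U A : L U -> is_isometry U ->
  average_orbit A (adjoint U * (A * U)).
Proof.
move=> LU isoU.
have := @orbit_average unit (fun=> U) A.
rewrite card_unit big_const card_unit /= addr0 invr1 scale1r; exact.
Qed.

Lemma orbit_refl A : average_orbit A A.
Proof.
have := @orbit_conj 1 A (@algebra1 R G) (fun=> erefl).
by rewrite adjoint_id mul1r mulr1.
Qed.

(** Averages compose, because products of isometries are isometries. *)
Lemma orbit_trans A A' A'' : average_orbit A A' -> average_orbit A' A'' ->
  average_orbit A A''.
Proof.
move=> [_ [n [U [n0 hU ->]]] <-] [_ [m [V [m0 hV ->]]] <-].
pose W (k : 'I_m * 'I_n) := U k.2 * V k.1.
have := @orbit_average _ W A.
rewrite card_prod !card_ord muln_gt0 m0 n0 => /(_ isT) hW.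
suff -> : m%:R^-1 *: (\sum_(i < m) bcomp (adjoint (V i)) (bcomp
    (n%:R^-1 *: (\sum_(j < n) bcomp (adjoint (U j)) (bcomp A (U j)))) (V i))) =
    (m * n)%:R^-1 *: (\sum_k adjoint (W k) * (A * W k)).
  apply: hW => k; first by apply: algebraM; [case: (hU k.2)|case: (hV k.1)].
  by move=> f; rewrite bopM (hU k.2).2 (hV k.1).2.
rewrite natrM invfM -scalerA; congr (_ *: _).
rewrite -(pair_bigA _ (fun i j => adjoint (W (i, j)) * (A * W (i, j)))) /=.
rewrite [RHS]scaler_sumr; apply: eq_bigr => i _.
rewrite !bcompE scale_bopl scale_bopr mulr_suml mulr_sumr; congr (_ *: _).
by apply: eq_bigr => j _; rewrite /W /= adjointM !bcompE !mulrA.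
Qed.

(** Averaging over the symmetry [1 - 2 L_x] and the identity removes the
off-diagonal part relative to [L_x]; doing so for one vertex keeps the
commutation with the other vertex projections. *)
Lemma orbit_commute_vertices (V : seq (vertex G)) A : L A -> exists A',
  [/\ average_orbit A A', L A' & {in V, forall x, Lv x * A' = A' * Lv x}].
Proof.
move=> LA; elim: V => [|x V [T [AT LT hT]]].
  by exists A; split=> //; exact: orbit_refl.
pose P := Lv x; have [U UE] : exists U : B, U = 1 - P *+ 2 by eexists.
have PU : P * U = - P.
  by rewrite UE mulrBr mulr1 mulrnAr vertex_idem mulr2n opprD addNKr.
have UP : U * P = - P.
  by rewrite UE mulrBl mul1r mulrnAl vertex_idem mulr2n opprD addNKr.
have UU : U * U = 1.
  by rewrite {1}UE mulrBl mul1r mulrnAl PU mulNrn opprK UE subrK.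
have Us : adjoint U = U.
  apply: adjoint_eq => f g.
  have Uh h : U h = h - (P h + P h) by rewrite UE.
  rewrite !Uh linearBl/= linearBr/= linearDl/= linearDr/=.
  by rewrite adjointP vertex_selfadjoint.
have LU : L U.
  rewrite UE; apply: algebraB; first exact: algebra1.
  by rewrite mulr2n; apply: algebraD; exact: algebra_vertex.
exists (2%:R^-1 *: (U * (T * U) + T)); split.
- apply: orbit_trans AT _.
  have := @orbit_average bool (fun b => if b then U else 1) T.
  rewrite card_bool big_bool /= Us adjoint_id mul1r mulr1; apply=> // -[] //.
    exact: algebra1.
  by apply: isometry_norm; rewrite Us UU.
- apply: algebraZ; apply: algebraD => //.
  by apply: algebraM => //; exact: algebraM.
- move=> y; rewrite inE scale_bopr scale_bopl => /predU1P[->|yV].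
    congr (_ *: _); rewrite -/P mulrDr mulrDl; transitivity ((P * (T * P)) *+ 2).
      by rewrite mulrA PU mulNr UE !mulrBr mulr1 !mulrnAr opprB subrK.
    rewrite -2!mulrA UP !mulrN UE mulrBl mul1r mulrnAl opprB.
    by rewrite subrK.
  have yU : Lv y * U = U * Lv y.
    by rewrite UE mulrBl mulrBr mul1r mulr1 mulrnAl mulrnAr vertex_comm.
  congr (_ *: _); rewrite mulrDr mulrDl (hT y yV); congr (_ + _).
  by rewrite mulrA yU -!mulrA -yU [Lv y * _]mulrA (hT y yV) -mulrA.
Qed.

(** The Hilbert space has dimension at most one here, so that every operator is a
scalar. *)
Lemma entry_commute T T' : (forall p q : dipath G, p = q) -> T * T' = T' * T.
Proof.
move=> pq.
have TE A p : exists a, A (xi p) = a *: xi p.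
  exists (A (xi p) p); apply: ell2P => q.
  by rewrite ell2Z (pq q p) xiE eqxx mulr1.
apply: bop_eq_xi => p; have [[a Ta] [b Tb]] := (TE T p, TE T' p).
by rewrite !bopM Ta Tb !bopfZ Ta Tb !scalerA mulrC.
Qed.

End averaging.

(** * A graph that is a single cycle *)

Section successor.
Variable G : digraph.
Implicit Types (x y : vertex G) (e : edge G).

Lemma walk_has_edge y s x : walk y s x -> y = x \/ exists e, src e = x.
Proof.
elim: s y => [y /eqP ->|e s IH y /= /andP[_ /IH[<-|ex]]].
- by left.
- by right; exists e.
- by right.
Qed.

(** When distinct edges have distinct sources, a strongly connected graph is a
single cycle: every vertex emits exactly one edge, so all walks follow one and
the same successor map, which must return to its starting point. *)
Lemma cycle_structure (e0 : edge G) : strongly_connected G ->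
  injective (@src G) ->
  exists eo : vertex G -> edge G, exists V : seq (vertex G), exists n : nat,
  [/\ forall x, src (eo x) = x, forall e, eo (src e) = e, uniq V,
      forall x, x \in V &
      (0 < n)%N /\ forall x, iter n (fun y => rng (eo y)) x = x].
Proof.
move=> sc srcI.
have /choice[eo eoK] : forall x, exists e : edge G, src e = x.
  move=> x.
  have [s /walk_has_edge[<-|//]] := strongly_connected_walk x (src e0) sc.
  by exists e0.
have srcK e : eo (src e) = e by apply: srcI.
pose nxt y := rng (eo y); pose v := src e0.
have walk_iter s x y : walk y s x -> y = iter (size s) nxt x.
  elim: s y => [y /eqP ->//|e s IH y /= /andP[/eqP <- /IH <-]].
  by rewrite /nxt srcK.
have [s /walk_iter vE] := strongly_connected_walk (nxt v) v sc.
pose n := (size s).+1.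
have nv : iter n nxt v = v by rewrite /n iterSr -vE.
have reach x : exists k, x = iter k nxt v.
  by have [t /walk_iter ->] := strongly_connected_walk v x sc; eexists.
exists eo, (undup [seq iter k nxt v | k <- iota 0 n]), n; split=> //.
- exact: undup_uniq.
- move=> x; have [k ->] := reach x; rewrite mem_undup.
  have -> : iter k nxt v = iter (k %% n) nxt v.
    rewrite [in LHS](divn_eq k n) addnC iterD iterM.
    by rewrite (iter_fix _ nv).
  by apply/mapP; exists (k %% n)%N; rewrite // mem_iota ltn_pmod.
- by split=> // x; have [k ->] := reach x; rewrite -iterD addnC iterD nv.
Qed.

End successor.

Section cycle.
Variables (R : realType) (G : digraph).
Local Notation B := (bop (dipath G) R).
Local Notation xi := (@xi (dipath G) R).
Local Notation L := (semigroupoid_algebra R G).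
Local Notation Lv := (@L_vertex R G).
Local Notation Le := (@L_edge R G).

(** The center is reached by two averages: one over symmetries that puts [A] in the
commutant of the vertex projections, and one over the powers of the isometry [S]
that prolongs every path by one edge. *)
Lemma orbit_meets_center_cycle (e0 : edge G) (A : B) :
  strongly_connected G -> injective (@src G) -> L A ->
  average_orbit A `&` semigroupoid_center R G !=set0.
Proof.
move=> sc srcI LA.
have [eo [V [n [eoK srcK uV inV [n0 nid]]]]] := cycle_structure e0 sc srcI.
pose nxt x := rng (eo x); pose prv := iter n.-1 nxt.
have prvK x : nxt (prv x) = x by rewrite -[RHS]nid -[in RHS](prednK n0).
have nxtK x : prv (nxt x) = x by rewrite -[RHS]nid -[in RHS](prednK n0) iterSr.
pose step w := pcat (epath (eo (path_rng w))) w.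
have stepE w : path_src (epath (eo (path_rng w))) = path_rng w.
  by rewrite path_src_epath eoK.
have rng_step w : path_rng (step w) = nxt (path_rng w) by rewrite rng_pcat.
have stepI : injective step.
  move=> w w' /(congr1 (@edges G)); rewrite !edges_pcat// => -[E1 E2].
  by apply: dipath_eq => //; rewrite -(eoK (path_rng w)) E1 eoK.
have [S SE LS] : exists2 S : B, forall w, S (xi w) = xi (step w) & L S.
  exists (\sum_(x <- V) Le (eo x)).
    move=> w; rewrite (sum_by_range_xi (g := fun x =>
      xi (pcat (epath (eo x)) w))) ?inV// => x.
    by rewrite L_edge_xi eoK.
  by apply: algebra_sum => x _; exact: algebra_edge.
have SS : adjoint S * S = 1.
  by apply: isometry_xi => p q; rewrite !SE l2dot_xi2 (inj_eq stepI).
have SLv x : S * Lv x = Lv (nxt x) * S.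
  apply: bop_eq_xi => w; rewrite !bopM SE !L_vertex_xi rng_step.
  by rewrite (can_eq nxtK) -SE; case: ifP; rewrite ?bop0.
have LeE e : Le e = S * Lv (src e).
  apply: bop_eq_xi => w; rewrite bopM L_edge_xi L_vertex_xi.
  by case: eqP => we; rewrite ?bop0// SE /step we srcK.
have SkLv k x : S ^+ k * Lv x = Lv (iter k nxt x) * S ^+ k.
  elim: k => [|k IH]; first by rewrite expr0 mul1r mulr1.
  by rewrite exprS -mulrA IH mulrA SLv -mulrA.
(* Vertex projections and [S] generate the algebra. *)
have commS T : (forall x, Lv x * T = T * Lv x) -> S * T = T * S ->
    forall T', L T' -> T' * T = T * T'.
  move=> TLv TS; apply: algebra_commutant => // e.
  by rewrite LeE -mulrA TLv mulrA TS -mulrA.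
have Sn T : L T -> T * S ^+ n = S ^+ n * T.
  by apply: commS => [x|]; [rewrite SkLv nid|rewrite -exprS -exprSr].
have SSk k : adjoint (S ^+ k) * S ^+ k = 1.
  elim: k => [|k IH]; first by rewrite expr0 adjoint_id mulr1.
  by rewrite exprSr adjointM mulrA -(mulrA (adjoint S)) IH mulr1.
(* The range of [S] is invariant under the algebra, hence compression to it is an
   endomorphism of the algebra. *)
have compress T : L T ->
    T * S = S * (adjoint S * (T * S)) /\ L (adjoint S * (T * S)).
  pose E := [set T | exists2 T', L T' & T * S = S * T'].
  have EP T1 : E T1 ->
      T1 * S = S * (adjoint S * (T1 * S)) /\ L (adjoint S * (T1 * S)).
    by move=> [T' LT' ->]; rewrite (mulrA (adjoint S)) SS mul1r.
  move=> LT; apply: (EP); move: T LT; apply: algebra_subset.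
  - split.
    + by exists 0; [exact: algebra0|rewrite mul0r mulr0].
    + move=> a T1 T2 [T1' L1 E1] [T2' L2 E2]; exists (a *: T1' + T2').
        by apply: algebraD => //; exact: algebraZ.
      by rewrite mulrDl mulrDr scale_bopl scale_bopr E1 E2.
    + move=> T1 T2 [T1' L1 E1] [T2' L2 E2]; exists (T1' * T2').
        exact: algebraM.
      by rewrite bcompE -mulrA E2 !mulrA E1.
  - move=> T clT; exists (adjoint S * (T * S)).
      apply: algebra_closed; move: (@wot_closure_mul _ _ _ T (adjoint S) S clT).
      by apply: closureS => _ [T1 /EP[_ ?] <-].
    have := @wot_closure_eq _ _ _ T 1 S (S * adjoint S) S clT.
    rewrite mul1r -mulrA; apply=> T1 /EP[+ _].
    by rewrite mul1r -mulrA.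
  - move=> e; exists (Lv (src e) * S); rewrite ?LeE -?mulrA//.
    by apply: algebraM => //; exact: algebra_vertex.
  - move=> x; exists (Lv (prv x)); first exact: algebra_vertex.
    by rewrite SLv prvK.
(* [T k] is the [k]-th iterated compression of [E]. *)
have [E [AE LE ELv]] := orbit_commute_vertices V LA.
pose T k := adjoint (S ^+ k) * (E * S ^+ k).
have T0 : T 0%N = E by rewrite /T expr0 adjoint_id mul1r mulr1.
have TS k : T k.+1 = adjoint S * (T k * S).
  by rewrite /T exprSr adjointM !mulrA.
have LT k : L (T k).
  by elim: k => [|k IH]; rewrite ?T0// TS; have [] := compress _ IH.
have STk k : T k * S = S * T k.+1.
  by rewrite TS; have [] := compress _ (LT k).
have Tn : T n = T 0%N by rewrite T0 /T Sn// mulrA SSk mul1r.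
have LvS x : adjoint S * Lv (nxt x) = Lv x * adjoint S.
  by rewrite -[Lv x]vertex_selfadjoint -adjointM SLv adjointM vertex_selfadjoint.
have TLv k x : Lv x * T k = T k * Lv x.
  elim: k x => [|k IH] x; first by rewrite T0 ELv.
  rewrite TS (mulrA (Lv x)) -LvS -(mulrA (adjoint S)).
  by rewrite (mulrA _ (T k)) IH -(mulrA (T k)) -SLv !mulrA.
pose D := n%:R^-1 *: \sum_(k < n) T k.
have DLv x : Lv x * D = D * Lv x.
  rewrite scale_bopl scale_bopr mulr_suml mulr_sumr.
  by congr (_ *: _); apply: eq_bigr => k _; exact: TLv.
(* Compression by [S] permutes [T 0, ..., T n = T 0] cyclically. *)
have DS : S * D = D * S.
  rewrite scale_bopl scale_bopr mulr_suml; congr (_ *: _).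
  under [RHS]eq_bigr do rewrite STk.
  rewrite -mulr_sumr; congr (_ * _).
  have := @big_ord_recl _ 0 +%R n (fun k : 'I_n.+1 => T k).
  by rewrite big_ord_recr /= Tn addrC => /addrI.
exists D; split.
  apply: orbit_trans AE _.
  have := @orbit_average _ _ _ (fun k : 'I_n => S ^+ k) E.
  rewrite card_ord; apply=> // k; last exact: isometry_norm.
  elim: (val k) => [|j IH]; first exact: algebra1.
  by rewrite exprS; exact: algebraM.
split; first by apply: algebraZ; apply: algebra_sum => k _.
by move=> T' LT'; rewrite !bcompE (commS D).
Qed.

End cycle.

(** * A vertex that emits two edges *)

Section words.
Variables (T : eqType) (x0 : T).
Implicit Types (s t u w : seq T).

Definition has_period d s :=
  forall i, (i + d < size s)%N -> nth x0 s (i + d) = nth x0 s i.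

(** An occurrence of [s] in [s ++ u'] shifted by [size w] makes [s] repeat with
that shift. *)
Lemma overlap_period w s u u' :
  w ++ (s ++ u) = s ++ u' -> has_period (size w) s.
Proof.
move=> E i id; have := congr1 (nth x0 ^~ (i + size w)) E.
rewrite nth_cat ltnNge leq_addl /= addnK !nth_cat id.
by rewrite (leq_ltn_trans (leq_addr _ _) id) => ->.
Qed.

Lemma has_period_catl d s t : has_period d (s ++ t) -> has_period d s.
Proof.
move=> per i id; have := per i; rewrite size_cat !nth_cat id.
rewrite (leq_ltn_trans (leq_addr _ _) id); apply.
exact: leq_trans id (leq_addr _ _).
Qed.

(** Every letter after the first [d] is a copy of the one [d] places before. *)
Lemma has_period_inj d s t : (0 < d)%N -> size s = size t ->
  take d s = take d t -> has_period d s -> has_period d t -> s = t.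
Proof.
move=> d0 st std ps pt; apply: (@eq_from_nth _ x0) => // i.
elim/ltn_ind: i => i IH si; have [id|di] := ltnP i d.
  by rewrite -(nth_take x0 id) std nth_take.
rewrite -(subnK di) ps ?pt -?st ?subnK//; apply: IH.
  by rewrite ltn_subrL d0 (leq_trans d0 di).
exact: leq_ltn_trans (leq_subr _ _) si.
Qed.

(** All code words have the same length, and two letters of [V] are told apart at
the blocks that correspond to their own positions. *)
Definition codeword (I : eqType) (a b : seq T) (V : seq I) (y : I) :=
  flatten [seq if y == x then b else a | x <- V].

Lemma size_codeword (I : eqType) (a b : seq T) (V : seq I) y :
  size a = size b -> size (codeword a b V y) = (size V * size a)%N.
Proof.
move=> ab; rewrite /codeword; elim: V => //= x V IH.
by rewrite size_cat IH mulSn; case: ifP; rewrite ?ab.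
Qed.

Lemma codeword_inj (I : eqType) (a b : seq T) (V : seq I) :
  size a = size b -> a != b -> {in V &, injective (codeword a b V)}.
Proof.
move=> sab ab y z yV _.
elim: V yV => // x V IH; rewrite inE => yV /= /eqP.
rewrite /codeword /= eqseq_cat; last by do 2 case: ifP.
move=> /andP[/eqP E1 /eqP E2]; case/predU1P: yV => [yx|/IH]; last exact.
move: E1; rewrite yx eqxx; case: eqP => // _ /eqP.
by rewrite eq_sym (negPf ab).
Qed.

End words.

Section branching.
Variable G : digraph.
Implicit Types (v : vertex G) (a b : seq (edge G)).

Lemma walk_flatten v (ss : seq (seq (edge G))) :
  (forall s, s \in ss -> walk v s v) -> walk v (flatten ss) v.
Proof.
elim: ss => [_|s ss IH h] /=; first exact: eqxx.
apply: walk_cat; first by apply: h; rewrite mem_head.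
by apply: IH => t tss; apply: h; rewrite inE tss orbT.
Qed.

(** Two closed walks at [v] of the same length generate closed walks without
small periods. A period [d] of a prefix longer than [d] determines how the word
goes on, so that at most one of the two continuations keeps it. *)
Lemma walk_without_period (e0 : edge G) v a b (D : nat) :
  walk v a v -> walk v b v -> size a = size b -> a != b ->
  exists2 m, walk v m v &
    forall d, (0 < d <= D)%N -> ~ has_period e0 d m.
Proof.
move=> va vb sab ab.
have a0 : (0 < size a)%N.
  rewrite lt0n; apply: contraNneq ab => a0; apply/eqP.
  by rewrite (size0nil a0) (size0nil (etrans (esym sab) a0)).
elim: D => [|D [m vm hm]].
  by exists [::]; [exact: eqxx|move=> d; rewrite ltnNge andNb].
pose r := m ++ flatten (nseq D.+1 a).
have vr : walk v r v.
  by apply: walk_cat vm _; apply: walk_flatten => s /nseqP[->].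
have rD : (D.+1 <= size r)%N.
  rewrite size_cat size_flatten /shape map_nseq sumn_nseq.
  by apply: leq_trans (leq_addl _ _); rewrite leq_pmull.
have [c [vc hc]] : exists c, walk v c v /\ ~ has_period e0 D.+1 (r ++ c).
  have [pa|npa] := pselect (has_period e0 D.+1 (r ++ a)); last by exists a.
  exists b; split=> // pb; move/eqP: ab; apply.
  have /eqP : r ++ a = r ++ b.
    apply: (has_period_inj _ _ _ pa pb) => //; first by rewrite !size_cat sab.
    by rewrite [LHS]takel_cat// [RHS]takel_cat.
  by rewrite eqseq_cat// => /andP[_ /eqP].
exists (r ++ c) => [|d]; first exact: walk_cat vr vc.
rewrite (leq_eqVlt d) ltnS => /andP[d0 /predU1P[->//|dD]].
rewrite -catA => /has_period_catl; apply: hm; exact/andP.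
Qed.

(** Close up both edges to walks [s e] and [t f] at their common source; the two
products of these walks have equal lengths and differ in the last edge. *)
Lemma distinct_closed_walks (e f : edge G) : strongly_connected G ->
  e != f -> src e = src f ->
  exists a b, [/\ walk (src e) a (src e), walk (src e) b (src e),
    size a = size b & a != b].
Proof.
move=> sc ef sef; set v := src e.
have [s vs] := strongly_connected_walk (rng e) v sc.
have [t vt] := strongly_connected_walk (rng f) v sc.
have ve : walk v (rcons s e) v.
  by rewrite -cats1; apply: walk_cat vs _; rewrite /= !eqxx.
have vf : walk v (rcons t f) v.
  by rewrite -cats1; apply: walk_cat vt _; rewrite /= -sef !eqxx.
exists (rcons s e ++ rcons t f), (rcons t f ++ rcons s e); split.
- exact: walk_cat ve vf.
- exact: walk_cat vf ve.
- by rewrite !size_cat addnC.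
- by rewrite -!rcons_cat eqseq_rcons negb_and (eq_sym f) ef orbT.
Qed.

End branching.

Section branching_average.
Variables (R : realType) (G : digraph).
Local Notation B := (bop (dipath G) R).
Local Notation xi := (@xi (dipath G) R).
Local Notation L := (semigroupoid_algebra R G).
Local Notation Lv := (@L_vertex R G).

(** The prefix of [y] is [m ++ g y ++ k y]: the walk [m] has no period in the
range where overlaps of the given paths could occur, the code word [g y] makes
the prefixes of different vertices incomparable, and [k y] leads from [y] to
[v]. *)
Lemma closure_orbit_scalar v (a b : seq (edge G)) (A : B) :
  strongly_connected G -> walk v a v -> walk v b v -> size a = size b ->
  a != b -> L A ->
  wot_closure (average_orbit A)
    (l2dot (A (xi (vpath v))) (xi (vpath v)) *: (1 : B)).
Proof.
move=> sc va vb sab ab LA; set c := l2dot _ _.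
have [e0 _] : exists e : edge G, e \in a ++ b.
  case: a b ab {va vb} sab => [|e a] [|f b] // _ _.
  by exists e; rewrite mem_head.
have [M hM] := bop_bounded A.
apply: (wot_closure_xi (M := M)) => F.
pose V := undup (v :: [seq path_rng w | w <- F]).
have uV : uniq V by exact: undup_uniq.
have vV : v \in V by rewrite mem_undup mem_head.
have FV w : w \in F -> path_rng w \in V.
  by move=> wF; rewrite mem_undup inE map_f ?orbT.
pose g := codeword a b V.
have /choice[k hk] : forall y, exists s, walk v s y.
  by move=> y; exact: strongly_connected_walk.
(* [D] bounds the length of a path [w] such that [w] times the prefixed path of
   some [q] is the prefixed path of some [q'] in [F]: the common prefix [m]
   cancels in the count of edges. *)
pose D := (\max_(y <- V) (size (g y) + size (k y)) +
  \max_(w <- F) size (edges w))%N.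
have [m vm hm] := walk_without_period e0 D va vb sab ab.
have /choice[p hp] : forall y, exists p,
    [/\ path_rng p = v, path_src p = y & edges p = m ++ (g y ++ k y)].
  move=> y; apply: walk_dipath; apply: walk_cat vm _; apply: walk_cat (hk y).
  by apply: walk_flatten => _ /mapP[x _ ->]; case: ifP.
have pr y : path_rng (p y) = v by have [] := hp y.
have ps y : path_src (p y) = y by have [] := hp y.
have pe y : edges (p y) = m ++ (g y ++ k y) by have [] := hp y.
pose phi w := if path_rng w \in V then pcat (p (path_rng w)) w else w.
have phiV w : path_rng w \in V -> edges (phi w) =
    m ++ (g (path_rng w) ++ (k (path_rng w) ++ edges w)).
  by move=> wV; rewrite /phi wV edges_pcat// pe -!catA.
have phi_rng w : path_rng w \in V -> path_rng (phi w) = v.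
  by move=> wV; rewrite /phi wV rng_pcat.
have phiN w : path_rng w \notin V -> phi w = w.
  by move=> /negPf wV; rewrite /phi wV.
have phiI : injective phi.
  move=> w w' E.
  have [wV|wV] := boolP (path_rng w \in V); last first.
    (* Paths with range outside [V] are fixed, while the others are sent to paths
       with range [v], which belongs to [V]. *)
    rewrite phiN// in E; have [w'V|w'V] := boolP (path_rng w' \in V).
      by move: wV; rewrite E phi_rng// vV.
    by rewrite E phiN.
  have [w'V|w'V] := boolP (path_rng w' \in V); last first.
    by rewrite (phiN w')// in E; move: w'V; rewrite -E phi_rng// vV.
  have rr : path_rng w = path_rng w'.
    have := congr1 (@edges G) E; rewrite !phiV// => /eqP.
    rewrite eqseq_cat// => /andP[_]; rewrite eqseq_cat ?size_codeword//.
    by move=> /andP[/eqP /(codeword_inj sab ab) + _]; exact.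
  by move: E; rewrite /phi wV w'V rr; apply: pcatI; rewrite ps.
pose U : B := \sum_(y <- V) Lop R (p y) + (1 - \sum_(y <- V) Lv y).
have UE w : U (xi w) = xi (phi w).
  have -> : U (xi w) = (\sum_(y <- V) Lop R (p y)) (xi w) +
    (xi w - (\sum_(y <- V) Lv y) (xi w)) by [].
  rewrite sum_vertex_xi// (sum_by_range_xi
    (g := fun y => xi (pcat (p y) w)))//.
    by rewrite /phi; case: ifP => _; rewrite ?subrr ?addr0// subr0 add0r.
  by move=> y; rewrite LopP ps eq_sym.
have LU : L U.
  apply: algebraD; first by apply: algebra_sum => y _; exact: algebra_Lop.
  apply: algebraB; first exact: algebra1.
  by apply: algebra_sum => y _; exact: algebra_vertex.
have isoU : {mono U : f / l2norm f}.
  apply: isometry_norm; apply: isometry_xi => w w'.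
  by rewrite !UE l2dot_xi2 (inj_eq phiI).
exists (adjoint U * (A * U)); split.
- exact: orbit_conj.
- by move=> f; exact: adjoint_isometry_le.
move=> q q' qF q'F.
rewrite !bopM adjointE !UE bopZ bop1 linearZl_LR/= l2dot_xi2.
have [<-|qq'] := eqVneq q q'.
  by rewrite mulr1 (algebra_diag _ LA) phi_rng//; exact: FV.
rewrite mulr0; apply/eqP; apply: contraT => /(algebra_entry_neq0 LA)[w wq wq'].
have := congr1 (@edges G) wq'; rewrite edges_pcat// !phiV ?FV// => E.
(* A trivial [w] would give [phi q = phi q']; otherwise [m] overlaps itself with
   the shift [size (edges w)]. *)
have w0 : (0 < size (edges w))%N.
  rewrite lt0n; apply: contra qq' => /nilP w0; apply/eqP/esym/phiI.
  rewrite wq'; apply: dipath_eq; rewrite ?edges_pcat ?w0// rng_pcat//.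
  by rewrite -wq /path_src w0.
case: (hm (size (edges w))); last exact: overlap_period (esym E).
have gk_le : (size (g (path_rng q')) + size (k (path_rng q')) <=
    \max_(y <- V) (size (g y) + size (k y)))%N.
  by apply: leq_bigmax_seq => //; exact: FV.
have q'_le : (size (edges q') <= \max_(w <- F) size (edges w))%N.
  exact: leq_bigmax_seq.
rewrite w0 /=; apply: leq_trans (leq_add gk_le q'_le).
have := congr1 size E; rewrite !size_cat [RHS]addnCA => /addnI Es.
by rewrite -addnA Es leq_addr.
Qed.

End branching_average.

(** * Averages in the center *)

Theorem theorem4p3 (R : realType) (G : digraph) :
  strongly_connected G ->
  forall A : bop (dipath G) R, semigroupoid_algebra R G A ->
    wot_closure (average_orbit A) `&` semigroupoid_center R G !=set0 /\
    (forall n : nat, circle_graph G n ->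
       average_orbit A `&` semigroupoid_center R G !=set0).
Proof.
move=> sc A LA; split; last first.
  move=> n [n0 [v [e [vbij ebij hve]]]].
  apply: (orbit_meets_center_cycle (e (Ordinal n0))) => // f f'.
  have [e' eK e'K] := ebij; rewrite -(e'K f) -(e'K f') !(hve _).2.
  by move=> /(bij_inj vbij)/ordS_inj ->.
have [[e0 _]|noe] := pselect (exists e : edge G, True); last first.
  exists A; split; first by apply: subset_closure; exact: orbit_refl.
  split=> // T _; apply: entry_commute => p q.
  have nil (w : dipath G) : edges w = [::].
    by case E : (edges w) => [//|e s]; case: noe; exists e.
  have [s] := strongly_connected_walk (path_rng p) (path_rng q) sc.
  case: s => [/eqP qp|e s]; last by case: noe; exists e.
  by apply: dipath_eq; rewrite ?nil.
have [srcI|] := pselect (injective (@src G)).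
  have [D [AD ZD]] := orbit_meets_center_cycle e0 sc srcI LA.
  by exists D; split=> //; exact: subset_closure.
move=> /existsNP[e] /existsNP[f] /not_implyP[sef /eqP ef].
have [a [b [va vb sab ab]]] := distinct_closed_walks sc ef sef.
eexists; split; first exact: closure_orbit_scalar sc va vb sab ab LA.
exact: center_scalar.
Qed.
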